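(* Let $\mathbf{X}_n$, $n\in\mathbb{Z}_+$, be a subcritical $p$-type Galton--Watson process (with immigration, as defined in the context) that has a stationary distribution $\pi$, and let $\alpha>0$ be a real number. Then the following statements are equivalent: (i) The distribution $\pi$ has finite moment of order $\alpha$, that is, $\int_{\mathbb{Z}_+^p}\|\mathbf{y}\|^\alpha\,\pi(d\mathbf{y})<\infty$. (ii) $E\|\boldsymbol{\eta}(1)\|^\alpha<\infty$, and $E\|\boldsymbol{\xi}_i(1,1)\|^\alpha<\infty$ for every type $i$ that does not die out. Furthermore, if (i) or (ii) is satisfied, then there exist finite constants $a_1>1$ and $a_2>0$ such that $$\sum_{n=0}^\infty a_1^n\sup_{f\in\mathcal{F}_\alpha}\bigg|E_{\mathbf{x}}f(\mathbf{X}_n)-\int_{\mathbb{Z}_+^p}f(\mathbf{y})\,\pi(d\mathbf{y})\bigg|\le a_2\big(\|\mathbf{x}\|^\alpha+1\big)$$ for every state $\mathbf{x}\in\mathcal{Z}$. If, additionally, $E\|\boldsymbol{\xi}_i(1,1)\|^\alpha<\infty$ for every type $i=1,\dots,p$, then there exist finite constants $a_1>1$ and $a_2>0$ such that this inequality holds for every $\mathbf{x}\in\mathbb{Z}_+^p$.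
   Context: $\mathbb{Z}_+$ is the set of nonnegative integers and $p$ is a positive integer. A $p$-type Galton--Watson process $\mathbf{X}_n=(X_{n,1},\dots,X_{n,p})^\top$, $n\in\mathbb{Z}_+$, is a $\mathbb{Z}_+^p$-valued Markov chain defined by the recursion $$\mathbf{X}_n=\sum_{i=1}^p\sum_{k=1}^{X_{n-1,i}}\boldsymbol{\xi}_i(n,k)+\boldsymbol{\eta}(n),\qquad n=1,2,\dots,$$ where the $\mathbb{Z}_+^p$-valued random vectors $\mathbf{X}_0$, $\boldsymbol{\xi}_i(n,k)$, $\boldsymbol{\eta}(n)$ ($i=1,\dots,p$; $n,k=1,2,\dots$) are independent of each other; for each $i$ the offspring variables $\boldsymbol{\xi}_i(n,k)$, $n,k\ge1$, are identically distributed; and the innovation variables $\boldsymbol{\eta}(n)$, $n\ge1$, are identically distributed. (The components of a single offspring or innovation vector may be dependent.) Standing assumption: all offspring variables have finite expectation. The mean matrix is $\mathbf{M}=[E\boldsymbol{\xi}_1(1,1),\dots,E\boldsymbol{\xi}_p(1,1)]^\top$ (so $M_{i,j}$ is the expectation of the $j$-th component of $\boldsymbol{\xi}_i(1,1)$), $\varrho(\mathbf{M})$ is its spectral radius, and the process is called subcritical if $\varrho(\mathbf{M})<1$. $M^{(n)}_{i,j}$ denotes the $(i,j)$-th entry of $\mathbf{M}^n$ (with $\mathbf{M}^0$ the identity matrix), and $\eta_j(n)$ denotes the $j$-th component of $\boldsymbol{\eta}(n)$. A stationary distribution is a probability measure on $\mathbb{Z}_+^p$ invariant for the Markov chain. For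 $\mathbf{x}\in\mathbb{R}^p$, $\|\mathbf{x}\|=|x_1|+\cdots+|x_p|$. $E_{\mathbf{x}}$ denotes expectation conditional on $\{\mathbf{X}_0=\mathbf{x}\}$ (i.e. for the chain started at $\mathbf{x}$). A type $i$ is said to die out if $P(\eta_j(1)=0)=1$ for every type $j$ for which there exists a nonnegative integer $n$ with $M^{(n)}_{j,i}>0$. $\mathcal{Z}$ is the set of states $\mathbf{x}=(x_1,\dots,x_p)^\top\in\mathbb{Z}_+^p$ such that $x_i=0$ for every type $i$ that dies out. For $\alpha>0$, $\mathcal{F}_\alpha=\{f:\mathbb{Z}_+^p\to\mathbb{R} : |f(\mathbf{x})|\le\|\mathbf{x}\|^\alpha+1 \text{ for all } \mathbf{x}\in\mathbb{Z}_+^p\}$. *)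

(* Defs.v *)
(* MathComp-Analysis development, over an abstract R : realType. *)
From HB Require Import structures.
From mathcomp Require Import all_boot all_order all_algebra.
From mathcomp Require Import finmap complex.
From mathcomp Require Import all_classical all_reals all_analysis.

Set Implicit Arguments.
Unset Strict Implicit.
Unset Printing Implicit Defensive.

Import Order.TTheory GRing.Theory Num.Theory.
Import numFieldNormedType.Exports.

Local Open Scope classical_set_scope.
Local Open Scope ring_scope.

(* Z_+^p with componentwise addition; being countable, it carries the
   sigma-algebra of all its subsets. *)
Definition state (p : nat) : Type := {ffun 'I_p -> nat}.

HB.instance Definition _ (p : nat) := GRing.Nmodule.on (state p).
HB.instance Definition _ (p : nat) := isPointed.Build (state p) 0.
HB.instance Definition _ (p : nat) :=
  @isMeasurable.Build default_measure_display (state p)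
    discrete_measurable discrete_measurable0
    discrete_measurableC discrete_measurableU.

Definition norm1 (R : realType) (p : nat) (x : state p) : R :=
  \sum_(i < p) `|(x i)%:R|.

Definition mutually_independent (R : realType) (d d' : measure_display)
    (Omega : measurableType d) (P : probability Omega R)
    (S : measurableType d') (I : choiceType) (D : set I)
    (Y : I -> {RV P >-> S}) : Prop :=
  forall (J : {fset I}) (B : I -> set S),
    [set` J] `<=` D -> (forall i, measurable (B i)) ->
    P (\bigcap_(i in [set` J]) (Y i @^-1` B i)) =
    (\prod_(i <- J) P (Y i @^-1` B i))%E.

Definition identically_distributed (R : realType) (d d' : measure_display)
    (Omega : measurableType d) (P : probability Omega R)
    (S : measurableType d') (Y Y' : {RV P >-> S}) : Prop :=
  forall A : set S, measurable A -> distribution P Y A = distribution P Y' A.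

(* For p > 0 the spectrum is finite and nonempty, so the sup is a maximum. *)
Definition spectral_radius (R : realType) (p : nat) (M : 'M[R]_p) : R :=
  sup [set complex.Re `|z| |
        z in [set z : R[i] | eigenvalue (map_mx (real_complex R) M) z]].

Section GaltonWatson.
Variables (R : realType) (p : nat).
Variables (d : measure_display) (Omega : measurableType d).
Variable P : probability Omega R.

(* xi i n k and eta n are only meaningful for n, k >= 1; the values at
   index 0 are never constrained nor used. *)
Variables (xi : 'I_p -> nat -> nat -> {RV P >-> state p}).
Variable eta : nat -> {RV P >-> state p}.

Definition GW_step (n : nat) (x : state p) (w : Omega) : state p :=
  \sum_(i < p) \sum_(1 <= k < (x i).+1) xi i n k w + eta n w.

(* The three summands index X_0, the xi i n k and the eta n respectively. *)
Definition GW_index : choiceType := (unit + 'I_p * nat * nat + nat)%type.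

Definition GW_family (X0 : {RV P >-> state p}) (u : GW_index) :
    {RV P >-> state p} :=
  match u with
  | inl (inl _) => X0
  | inl (inr (i, n, k)) => xi i n k
  | inr n => eta n
  end.

Definition GW_index_valid : set GW_index :=
  [set u | match u with
           | inl (inl _) => true
           | inl (inr (_, n, k)) => (1 <= n)%N && (1 <= k)%N
           | inr n => (1 <= n)%N
           end].

Record GW_process (X : nat -> {RV P >-> state p}) : Prop := {
  GW_recursion : forall n w, X n.+1 w = GW_step n.+1 (X n w) w ;
  GW_independent : mutually_independent GW_index_valid (GW_family (X 0)) ;
  GW_offspring_id : forall i n k, (1 <= n)%N -> (1 <= k)%N ->
    identically_distributed (xi i n k) (xi i 1%N 1%N) ;
  GW_innovation_id : forall n, (1 <= n)%N ->
    identically_distributed (eta n) (eta 1%N)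
}.

Definition mean_matrix : 'M[R]_p :=
  \matrix_(i < p, j < p) fine 'E_P[fun w => (xi i 1%N 1%N w j)%:R]%E.

Definition dies_out (i : 'I_p) : Prop :=
  forall j : 'I_p, (exists n : nat, 0 < (mean_matrix ^+ n) j i) ->
    P [set w | eta 1%N w j = 0%N] = 1%E.

Definition no_dying_type : set (state p) :=
  [set x | forall i, dies_out i -> x i = 0%N].

(* The chain started at x, driven by the same offspring and innovations. *)
Fixpoint GW_from (x : state p) (n : nat) (w : Omega) : state p :=
  if n is m.+1 then GW_step m.+1 (GW_from x m w) w else x.

(* E_x f(X_n). Since X_0 is independent of the offspring and innovations, this
   is the conditional expectation given X_0 = x whenever P(X_0 = x) > 0. *)
Definition expectation_from (x : state p) (n : nat) (f : state p -> R) :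
    \bar R :=
  'E_P[fun w => f (GW_from x n w)]%E.

(* pi is invariant under the transition kernel A |-> P(X_1 \in A | X_0 = x). *)
Definition stationary (pi : probability (state p) R) : Prop :=
  forall A : set (state p),
    pi A = (\int[pi]_x P [set w | A (GW_from x 1%N w)])%E.

Definition growth_class (alpha : R) : set (state p -> R) :=
  [set f | forall x, `|f x| <= norm1 R x `^ alpha + 1].

(* The absolute value below is +oo as soon as one of the two integrals is
   infinite, in particular when both are and the difference is +oo - +oo. *)
Definition distance_from (pi : probability (state p) R) (alpha : R)
    (x : state p) (n : nat) : \bar R :=
  ereal_sup [set `|expectation_from x n f - \int[pi]_y (f y)%:E|%E |
              f in growth_class alpha].

End GaltonWatson.

(* Main.v *)
(* Only independence and stationarity in law are used: the transition kernel K
   of the chain and the kernel B of the process without immigration satisfy the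
   branching property K^n(x + y, .) = K^n(x, .) * B^n(y, .) (convolution), so the
   chain started at x is, in law, the chain started at 0 plus an independent
   immigration-free process Z started at x.

   M^n -> 0 since rho(M) < 1.  If alpha <= 1, a tangent-line bound turns this into
   contraction of E ||Z_n||^alpha; if alpha > 1, a Rosenthal-type inequality
   E ||Z_n||^alpha <= C (s_n ||x||)^alpha + C_n ||x|| shows that
   ||x||^alpha + c ||x|| is contracted by some power of B.  Hence
   E_x ||Z_n||^alpha <= C theta^n ||x||^alpha on the set of states without dying
   types, and this bounds P(Z_n <> 0) as well since ||.|| >= 1 off 0.

   Consequently the alpha-moments of the chain started at 0 are bounded along a
   subsequence, and pi, being the limit of these laws on bounded functions, has a
   finite alpha-moment.  For |f| <= ||.||^alpha + 1 the difference f(u + v) - f(u)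
   vanishes for v = 0 and is at most C (||u||^alpha + 1) ||v||^alpha, so E_x f(X_n)
   and pi(f) are both within O(theta^n) of E_0 f(X_n).  Conversely pi dominates the
   laws of the immigrants and, weighted by the positive mass of the states
   containing type i, of the offspring of i. *)
Require Import Defs.
From HB Require Import structures.
From mathcomp Require Import all_boot all_order all_algebra.
From mathcomp Require Import finmap complex.
From mathcomp Require Import ring lra.
From mathcomp Require Import all_classical all_reals all_analysis.
From mathcomp Require Import measurable_realfun.

Set Implicit Arguments.
Unset Strict Implicit.
Unset Printing Implicit Defensive.

Import Order.TTheory GRing.Theory Num.Theory.
Import numFieldNormedType.Exports.

Local Open Scope classical_set_scope.
Local Open Scope ring_scope.

(** * Powers of a matrix with spectral radius less than one *)

(** Only nonnegative functions with values in the extended reals are integrated, and kernels are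
    iterated as operators on them. A signed function is handled through its positive and negative
    parts f1, f2, and estimates for f1 - f2 are inequalities between sums, so no difference of
    infinite quantities can occur. The set [D] of excluded types is a parameter. Types outside [D]
    have no offspring in [D], and there is no immigration in [D]; hence the states avoiding [D] are
    closed under the dynamics and moments are required only outside [D]. Both the dying types and
    the empty set qualify, which gives the two convergence statements. For alpha > 1 the obstacle is
    the linear term, whose constant C_n need not be small. The time N is fixed first, using first
    moments; the weight c is then taken large compared with C_N. Since the linear function itself
    contracts over N steps, the weighted sum contracts however large C_N is. The bound on the
    moments of the chain from 0 that is uniform in time comes from monotonicity: 0 is the
    stochastically smallest start, so these moments are at most that of pi. *)

(** Because t exceeds rho strictly, any D with C <= D (t - rho) makes D t^n an invariant bound. The
    gap absorbs the polynomial factors that repeated eigenvalues would create, and the rate t is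
    kept. *)
Lemma geometric_recurrence (R : realType) (l : R[i]) (rho C t : R) (x y : nat -> R[i]) :
  `|l| <= rho%:C%C -> rho < t < 1 -> 0 <= t ->
  (forall n, x n.+1 = l * x n + y n) ->
  (forall n, `|y n| <= (C * t ^+ n)%:C%C) ->
  exists C' t' : R, [/\ rho < t' < 1, 0 <= t' & forall n, `|x n| <= (C' * t' ^+ n)%:C%C].
Proof.
move=> llr /andP[rt t1] t0 xE yC.
pose D := Num.max (complex.Re `|x 0%N|) (C / (t - rho)).
have trho : 0 < t - rho by rewrite subr_gt0.
have rho0 : 0 <= rho by rewrite -(lecR 0 rho); exact: (le_trans (normr_ge0 l) llr).
exists D, t; split => //; first by rewrite rt.
elim=> [|n IH].
  by rewrite expr0 mulr1 -(RRe_real (normr_real (x 0%N))) lecR le_max lexx.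
rewrite xE; apply: (le_trans (ler_normD _ _)).
rewrite normrM.
apply: (@le_trans _ _ (rho%:C * (D * t ^+ n)%:C + (C * t ^+ n)%:C)%C).
  by apply: lerD => //; apply: ler_pM.
rewrite -rmorphM -rmorphD lecR exprS.
have CD : C <= D * (t - rho) by rewrite -ler_pdivrMr// le_max lexx orbT.
have tn : 0 <= t ^+ n by rewrite exprn_ge0.
nra.
Qed.

(* By Cayley-Hamilton this applies to the roots of the characteristic polynomial;
   peeling off one factor A - z turns the entries of A^n V into solutions of a
   first-order recurrence with coefficient z. *)
Lemma char_roots_matrix_decay (R : realType) p (A V : 'M[R[i]]_p.+1) (rs : seq R[i]) (rho : R) :
  rho < 1 -> 0 <= rho -> {in rs, forall z, `|z| <= rho%:C%C} ->
  horner_mx A (\prod_(z <- rs) ('X - z%:P)) *m V = 0 ->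
  forall i j, exists C t : R, [/\ rho < t < 1, 0 <= t &
    forall n, `|(A ^+ n *m V) i j| <= (C * t ^+ n)%:C%C].
Proof.
move=> rho1 rho0; elim: rs V => [|z rs IH] V rsrho.
  (* No root is left, so V = 0; the midpoint of rho and 1 is an arbitrary admissible rate. *)
  rewrite big_nil rmorph1 mul1mx => -> i j.
  exists 0, ((1 + rho) / 2); split; [lra|lra|].
  by move=> n; rewrite mulmx0 mxE normr0 mul0r lexx.
rewrite big_cons mulrC rmorphM /= rmorphB /= horner_mx_X horner_mx_C -mulmxA => h i j.
have [|C [t [rt t0 Ht]]] := IH ((A - z%:M) *m V) _ h i j.
  by move=> y yrs; apply: rsrho; rewrite inE yrs orbT.
apply: (geometric_recurrence (l := z) (C := C) (t := t)
  (x := fun n => (A ^+ n *m V) i j) (y := fun n => (A ^+ n *m ((A - z%:M) *m V)) i j)) => //.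
  by apply: rsrho; rewrite inE eqxx.
move=> n /=; rewrite mulmxBl mulmxBr mulmxA -[A ^+ n *m A]/(A ^+ n * A) -exprSr.
rewrite mul_scalar_mx -scalemxAr !mxE; ring.
Qed.

Lemma subcritical_exp_cvg (R : realType) p (M : 'M[R]_p) :
  spectral_radius M < 1 ->
  forall i j, (M ^+ n) i j @[n --> \oo] --> 0.
Proof.
case: p M => [M _ []//|p M]; set A := map_mx (real_complex R) M => rM i j.
have [rs rsE] := closed_field_poly_normal (char_poly A).
rewrite (monicP (char_poly_monic A)) scale1r in rsE.
have eigE z : eigenvalue A z = (z \in rs).
  by rewrite eigenvalue_root_char rsE root_prod_XsubC.
pose rho := spectral_radius M.
pose E := [set complex.Re `|z| | z in [set z : R[i] | eigenvalue A z]].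
have ubE : has_ubound E.
  (* The supremum dominates the eigenvalues only if the spectrum is bounded; the sum of all moduli
     is a crude bound. *)
  exists (\sum_(z <- rs) complex.Re `|z|) => _ [z zE <-].
  have zrs : z \in rs by rewrite -eigE.
  have re_ge0 (y : R[i]) : 0 <= complex.Re `|y|.
    by rewrite -(lecR 0) RRe_real ?normr_real ?normr_ge0.
  by rewrite (perm_big _ (perm_to_rem zrs)) big_cons lerDl sumr_ge0.
have rsrho : {in rs, forall z, `|z| <= rho%:C%C}.
  move=> z; rewrite -eigE => zE.
  rewrite -(RRe_real (normr_real z)) lecR /rho /spectral_radius.
  by apply: ub_le_sup => //; exists z.
have rho0 : 0 <= rho.
  have [z zrs] : exists z, z \in rs.
    case: rs rsE {eigE rsrho} => [rsE|z rs _]; last by exists z; rewrite inE eqxx.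
    by have := size_char_poly A; rewrite rsE big_nil size_poly1.
  by rewrite -(lecR 0 rho); exact: (le_trans (normr_ge0 z) (rsrho _ zrs)).
have h : horner_mx A (\prod_(z <- rs) ('X - z%:P)) *m 1%:M = 0.
  by rewrite -rsE Cayley_Hamilton mul0mx.
have [C [t [/andP[_ t1] t0 H]]] := char_roots_matrix_decay rM rho0 rsrho h i j.
have H' n : `|(M ^+ n) i j| <= C * t ^+ n.
  have := H n; rewrite mulmx1.
  have -> : A ^+ n = map_mx (real_complex R) (M ^+ n).
    by rewrite rmorphXn.
  rewrite mxE normc_def /= expr0n /= addr0 sqrtr_sqr.
  by rewrite lecR.
have t1' : `|t| < 1 by rewrite ger0_norm.
apply/norm_cvg0P; apply: (squeeze_cvgr _ (cvg_cst 0)).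
  by near=> n; rewrite normr_ge0; exact: H'.
rewrite -[X in _ --> X](mulr0 C); by apply: cvgM; [exact: cvg_cst|exact: cvg_expr].
Unshelve. all: by end_near.
Qed.

(** * Sums over the fibers of a countable-valued map *)

HB.instance Definition _ (p : nat) := Countable.on (state p).

(** Applied once to K and once to its inverse, this single inequality yields the equality in
    [esumZl]. *)
Lemma le_esumZl (R : realType) (C : choiceType) (K : R) (a : C -> \bar R) :
  0 <= K -> (forall c, 0 <= a c)%E ->
  (\esum_(c in setT) (K%:E * a c) <= K%:E * \esum_(c in setT) a c)%E.
Proof.
move=> K0 a0; apply: ge_ereal_sup => _ [X [finX _] <-].
rewrite -ge0_mule_fsumr//; apply: lee_wpmul2l; first by rewrite lee_fin.
by apply: esum_ge; exists X.
Qed.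

Lemma esumZl (R : realType) (C : choiceType) (K : \bar R) (a : C -> \bar R) :
  (0 <= K)%E -> (forall c, 0 <= a c)%E ->
  (\esum_(c in setT) (K * a c) = K * \esum_(c in setT) a c)%E.
Proof.
move=> K0 a0; have [->|Kn0] := eqVneq K 0%E.
  by rewrite mul0e esum1// => c _; rewrite mul0e.
case: K K0 Kn0 => [r||//] K0 Kn0; last first.
  have [az|/existsNP [c /eqP ac]] := pselect (forall c, a c = 0%E).
    by rewrite !esum1 ?mule0// => c _; rewrite ?az ?mule0.
  have ac0 : (0 < a c)%E by rewrite lt0e ac a0.
  have le_term (f : C -> \bar R) : (forall i, 0 <= f i)%E -> (f c <= \esum_(i in setT) f i)%E.
    move=> f0; apply: esum_ge; exists [set c]; last by rewrite fsbig_set1.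
    by split => //; exact: finite_set1.
  have lt_esum := lt_le_trans ac0 (le_term _ a0).
  rewrite gt0_mulye//; apply/eqP; rewrite -leye_eq.
  have h := le_term (fun i => +oo * a i)%E (fun i => mule_ge0 K0 (a0 i)).
  by apply: le_trans h; rewrite gt0_mulye.
have r0 : 0 < r by rewrite lt_neqAle eq_sym -eqe Kn0 -lee_fin.
apply/eqP; rewrite eq_le le_esumZl ?(ltW r0)//=.
rewrite muleC -lee_pdivlMr// muleC.
apply: le_trans (le_esumZl _ _); rewrite ?invr_ge0 ?(ltW r0)//; last by move=> c;
  rewrite mule_ge0.
by apply: le_esum => c _; rewrite muleA -EFinM mulVf ?gt_eqF// mul1e.
Qed.

Lemma esum_exchange (R : realType) (C C' : choiceType) (a : C -> C' -> \bar R) :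
  (forall c c', 0 <= a c c')%E ->
  \esum_(c in setT) \esum_(c' in setT) a c c' =
  \esum_(c' in setT) \esum_(c in setT) a c c'.
Proof.
move=> a0; rewrite !esum_esum//.
rewrite (@reindex_esum R _ _ (setT `*`` (fun=> setT)) _ (fun k => (k.2, k.1)))//.
by split=> [//|[x y] [z t] _ _ [-> ->]//|[x y] _]; exists (y, x).
Qed.

Section fibers.
Variables (R : realType) (d : measure_display) (Omega : measurableType d).
Variable mu : {measure set Omega -> \bar R}.

(** Countable additivity is available along nat, so the fibers are numbered by [pickle]; numbers
    that code no element give empty pieces. *)
Lemma ge0_integral_fibers (C : countType) (g : Omega -> C) (D : set Omega)
    (F : Omega -> \bar R) :
  measurable D -> (forall c, measurable (g @^-1` [set c])) ->
  measurable_fun D F -> (forall w, D w -> 0 <= F w)%E ->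
  (\int[mu]_(w in D) F w =
   \esum_(c in setT) \int[mu]_(w in D `&` g @^-1` [set c]) F w)%E.
Proof.
move=> mD mg mF F0.
pose G n := D `&` [set w | choice.pickle (g w) = n].
have GE n : G n = if choice.unpickle n is Some c then
    if choice.pickle c == n then D `&` g @^-1` [set c] else set0 else set0.
  rewrite /G; case E: (choice.unpickle n) => [c|].
    case: eqP => [cn|cn].
      congr (_ `&` _); apply/seteqP; split => w /= h.
        by apply: (pcan_inj choice.pickleK); rewrite cn.
      by rewrite h cn.
    apply/seteqP; split => w //= -[_ h]; apply: cn.
    by move: E; rewrite -h choice.pickleK => -[<-].
  apply/seteqP; split => w //= -[_ h].
  by move: E; rewrite -h choice.pickleK.
have mG n : measurable (G n).
  by rewrite GE; case: choice.unpickle => [c|//]; case: ifP => // _; apply: measurableI.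
have DE : D = \bigcup_n G n.
  by apply/seteqP; split => [w Dw|w [n _ []//]]; exists (choice.pickle (g w)).
have tG : trivIset [set: nat] G.
  by move=> i j _ _ [w [[_ /= <-] [_ /= <-]]].
rewrite [in LHS]DE ge0_integral_bigcup -?DE//.
rewrite nneseries_esumT; last first.
  by move=> n; apply: integral_ge0 => w [Dw _]; exact: F0.
rewrite (esumID (range (choice.pickle : C -> nat))) ?setTI; last first.
  by move=> n _; apply: integral_ge0 => w [Dw _]; exact: F0.
rewrite [X in (_ + X)%E]esum1 ?adde0; last first.
  move=> n hn; rewrite GE; case E: choice.unpickle => [c|]; last by rewrite integral_set0.
  by case: eqP => [cn|]; [case: hn; exists c|rewrite integral_set0].
rewrite esum_image; last by move=> x y _ _; exact: (pcan_inj (@choice.pickleK C)).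
by apply: eq_esum => c _; rewrite GE choice.pickleK eqxx.
Qed.

Lemma ge0_integral_comp_fibers (C : countType) (g : Omega -> C) (D : set Omega)
    (H : C -> \bar R) :
  measurable D -> (forall c, measurable (g @^-1` [set c])) ->
  (forall c, 0 <= H c)%E -> measurable_fun D (H \o g) ->
  (\int[mu]_(w in D) H (g w) =
   \esum_(c in setT) H c * mu (D `&` g @^-1` [set c]))%E.
Proof.
move=> mD mg H0 mH; rewrite (@ge0_integral_fibers _ g)//.
apply: eq_esum => c _.
transitivity (\int[mu]_(w in D `&` g @^-1` [set c]) cst (H c) w)%E.
  by apply: eq_integral => w /set_mem [_ /= ->].
by rewrite integral_cst//; exact: measurableI.
Qed.

Lemma measure_fibers (C : countType) (g : Omega -> C) (D : set Omega) :
  measurable D -> (forall c, measurable (g @^-1` [set c])) ->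
  (mu D = \esum_(c in setT) mu (D `&` g @^-1` [set c]))%E.
Proof.
move=> mD mg; have <- : (\int[mu]_(w in D) cst 1%E w = mu D)%E by rewrite integral_cst// mul1e.
rewrite (@ge0_integral_comp_fibers _ g _ (fun=> 1%E))//; last exact: measurable_cst.
by apply: eq_esum => c _; rewrite mul1e.
Qed.

Lemma measurable_fun_fibers (C : countType) (g : Omega -> C)
    (d' : measure_display) (T : measurableType d') (H : C -> T) (D : set Omega) :
  (forall c, measurable (g @^-1` [set c])) -> measurable_fun D (H \o g).
Proof.
move=> mg mD A mA.
rewrite (_ : D `&` _ = D `&` \bigcup_(c in H @^-1` A) (g @^-1` [set c])).
  apply: measurableI => //; rewrite bigcup_mkcond.
  apply: countable_bigcupT_measurable; first exact: countableP.
  by move=> c; case: ifP.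
congr (_ `&` _); apply/seteqP; split => w /=; first by exists (g w).
by case=> c /= Hc ->.
Qed.

End fibers.

(** * Expectation functionals on the state space *)

Section discrete_integral.
Variables (R : realType) (p : nat).
Local Notation S := (state p).
Local Open Scope ereal_scope.

Lemma integral_state (mu : probability S R) (f : S -> \bar R) :
  (forall x, 0 <= f x) ->
  \int[mu]_x f x = \esum_(x in setT) (fine (mu [set x]))%:E * f x.
Proof.
move=> f0; rewrite (@ge0_integral_comp_fibers _ _ _ mu _ id)//.
by apply: eq_esum => c _; rewrite setTI fineK ?fin_num_measure// muleC.
Qed.

(** Tonelli on a countable space: both sides are double sums, so no product measure is formed. *)
Lemma integral_state_exchange (mu nu : probability S R) (f : S -> S -> \bar R) :
  (forall x y, 0 <= f x y) ->
  \int[mu]_x \int[nu]_y f x y = \int[nu]_y \int[mu]_x f x y.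
Proof.
move=> f0.
have fine0 (m : probability S R) c : (0 <= fine (m [set c]))%R by rewrite fine_ge0.
rewrite !integral_state; [|by move=> x; apply: integral_ge0..].
under eq_esum => c _.
  rewrite integral_state// -esumZl ?lee_fin//; last by move=> y;
    rewrite mule_ge0// lee_fin.
  over.
under [RHS]eq_esum => c _.
  rewrite integral_state// -esumZl ?lee_fin//; last by move=> y;
    rewrite mule_ge0// lee_fin.
  over.
rewrite esum_exchange; last by move=> x y; rewrite !mule_ge0// lee_fin.
apply: eq_esum => y _; apply: eq_esum => x _.
by rewrite muleCA.
Qed.

(* The properties of the expectation functionals of probability laws that
   survive composition of kernels, so that iterated kernels need not be built. *)
Record mean_op (L : (S -> \bar R) -> \bar R) : Prop := {
  mean_le_ae : forall (A : set S) (f g : S -> \bar R),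
    L (fun x => (\1_A x)%:E) = 0 -> (forall x, 0 <= f x) -> (forall x, 0 <= g x) ->
    (forall x, ~ A x -> f x <= g x) -> L f <= L g ;
  meanD : forall f g : S -> \bar R, (forall x, 0 <= f x) -> (forall x, 0 <= g x) ->
    L (fun x => f x + g x) = L f + L g ;
  meanZ : forall (c : R) (f : S -> \bar R), (0 <= c)%R -> (forall x, 0 <= f x) ->
    L (fun x => c%:E * f x) = c%:E * L f ;
  mean_cst : forall c : \bar R, L (fun=> c) = c ;
  mean_exchange : forall (nu : probability S R) (f : S -> S -> \bar R),
    (forall x y, 0 <= f x y) ->
    L (fun x => \int[nu]_y f x y) = \int[nu]_y L (fun x => f x y)
}.

Section mean_op_theory.
Variables (L : (S -> \bar R) -> \bar R) (mL : mean_op L).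

Lemma mean_le (f g : S -> \bar R) :
  (forall x, 0 <= f x) -> (forall x, f x <= g x) -> L f <= L g.
Proof.
move=> f0 fg; apply: (mean_le_ae mL (A := set0)) => // [|x].
  by rewrite -[RHS](mean_cst mL); congr L; apply/funext => x; rewrite indic0.
exact: (le_trans (f0 x)).
Qed.

Lemma mean_ge0 (f : S -> \bar R) : (forall x, 0 <= f x) -> 0 <= L f.
Proof. by move=> f0; rewrite -[leLHS](mean_cst mL); apply: mean_le. Qed.

Lemma mean_sum (I : Type) (r : seq I) (f : I -> S -> \bar R) :
  (forall i x, 0 <= f i x) ->
  L (fun x => \sum_(i <- r) f i x) = \sum_(i <- r) L (f i).
Proof.
move=> f0; elim: r => [|i r IH].
  rewrite big_nil -[RHS](mean_cst mL); congr L; apply/funext => x.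
  by rewrite big_nil.
rewrite big_cons -IH -(meanD mL)//; last by move=> x; apply: sume_ge0.
by congr L; apply/funext => x; rewrite big_cons.
Qed.

End mean_op_theory.

Lemma mean_op_integral (mu : probability S R) : mean_op (fun f => \int[mu]_x f x).
Proof.
split.
- move=> A f g A0 f0 g0 fg; apply: ae_ge0_le_integral => //.
  exists A; split => //.
    by rewrite -A0 integral_indic// setIT.
  move=> x /= h; apply: contrapT => nA; apply: h => _; exact: fg.
- by move=> f g f0 g0; rewrite ge0_integralD.
- by move=> c f c0 f0; rewrite ge0_integralZl.
- by move=> c; rewrite integral_cst//= probability_setT mule1.
- by move=> nu f f0; exact: integral_state_exchange.
Qed.

Definition kernel_op (k : S -> probability S R) (f : S -> \bar R) (x : S) : \bar R :=
  \int[k x]_y f y.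

Lemma mean_op_iter (k : S -> probability S R) n x :
  mean_op (fun f => iter n (kernel_op k) f x).
Proof.
elim: n x => [|n IH] x.
  (* With zero steps the functional is evaluation at x, and a null A is one that does not contain
     x. *)
  split => //= A f g A0 f0 g0; apply => Ax.
  by move: A0; rewrite indicE mem_set// => /eqP; rewrite eqe oner_eq0.
pose L f := \int[k x]_y f y.
have mL : mean_op L := mean_op_integral (k x).
have it0 f y : (forall x, 0 <= f x) -> 0 <= iter n (kernel_op k) f y.
  exact: (mean_ge0 (IH y)).
split => /=.
- move=> A f g A0 f0 g0 fg.
  (* [B] collects the states from which n further steps charge [A]. It is null for [k x], since a
     nonnegative function with zero integral vanishes almost everywhere; outside it the induction
     hypothesis applies. *)
  pose B := [set y | iter n (kernel_op k) (fun x => (\1_A x)%:E) y != 0].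
  apply: (mean_le_ae mL (A := B)); last 1 first.
  + move=> y /negP; rewrite negbK => /eqP h.
    exact: (mean_le_ae (IH y) h).
  + apply/eqP; rewrite /L integral_indic// setIT.
    have [] : ae_eq (k x) setT (iter n (kernel_op k) (fun x => (\1_A x)%:E)) (cst 0).
      apply/ae_eq_integral_abs => //; rewrite -[RHS]A0; apply: eq_integral => y _.
      by rewrite gee0_abs// it0// => z; rewrite lee_fin.
    move=> N [_ N0 BN]; rewrite eq_le measure_ge0 andbT -N0; apply: le_measure => //.
    + by rewrite inE.
    + by rewrite inE.
    + by move=> y /= By; apply: BN => /= h; move/eqP: By; apply; exact: h.
  + by move=> y; exact: it0.
  + by move=> y; exact: it0.
- move=> f g f0 g0; rewrite /kernel_op -(meanD mL).
  + by apply: eq_integral => y _; exact: (meanD (IH y)).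
  + by move=> y; exact: it0.
  + by move=> y; exact: it0.
- move=> c f c0 f0; rewrite /kernel_op -(meanZ mL)//.
  + by apply: eq_integral => y _; exact: (meanZ (IH y)).
  + by move=> y; exact: it0.
- move=> c; rewrite /kernel_op -[RHS](mean_cst mL).
  by apply: eq_integral => y _; exact: (mean_cst (IH y)).
- move=> nu f f0; rewrite /kernel_op.
  rewrite (integral_state_exchange nu (k x)); last by move=> u v; apply: it0.
  by apply: eq_integral => y _; exact: (mean_exchange (IH y)).
Qed.

End discrete_integral.

(** * Inequalities for real powers *)

Section powR_inequalities.
Variables (R : realType) (alpha : R).
Hypothesis alpha_gt0 : 0 < alpha.

Lemma powR_le (x y : R) : 0 <= x -> x <= y -> x `^ alpha <= y `^ alpha.
Proof.
by move=> x0 xy; rewrite ge0_ler_powR ?nnegrE ?(ltW alpha_gt0)// (le_trans x0).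
Qed.

Lemma powR_add_le (x y : R) : 0 <= x -> 0 <= y ->
  (x + y) `^ alpha <= 2 `^ alpha * (x `^ alpha + y `^ alpha).
Proof.
wlog xy : x y / x <= y.
  move=> h x0 y0; case: (leP x y) => [xy|/ltW yx]; first exact: h.
  by rewrite addrC [X in _ * X]addrC; apply: h.
move=> x0 y0; apply: (@le_trans _ _ ((2 * y) `^ alpha)).
  by apply: powR_le; [exact: addr_ge0|lra].
by rewrite powRM// ler_wpM2l ?powR_ge0// lerDr powR_ge0.
Qed.

(** The true tangent at s has slope alpha s^(alpha-1), at most the slope used here; with the larger
    slope the cases t <= s and t > s suffice, without derivatives. *)
Lemma powR_le_tangent (s t : R) : alpha <= 1 -> 0 < s -> 0 <= t ->
  t `^ alpha <= s `^ alpha + s `^ (alpha - 1) * t.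
Proof.
move=> a1 s0 t0; case: (leP t s) => [ts|/[dup] st /ltW st'].
  by rewrite (le_trans (powR_le t0 ts))// lerDl mulr_ge0// powR_ge0.
have tp : 0 < t := lt_trans s0 st.
rewrite -[leLHS]mulr_powRB1// mulrC (@le_trans _ _ (s `^ (alpha - 1) * t))//; last first.
  by rewrite lerDr powR_ge0.
rewrite ler_wpM2r// /powR !gt_eqF// ler_expR ler_wnM2l ?subr_le0//.
by rewrite ler_ln ?posrE.
Qed.

(** The first summand serves increments y >= s, the second bounds ((1+t)^alpha - 1) / t for t = y/s
    in (0, 1]. *)
Definition increment_cst : R := 2 `^ alpha + alpha * expR alpha.

Lemma increment_cst_gt0 : 0 < increment_cst.
Proof. by rewrite addr_gt0 ?powR_gt0// mulr_gt0// expR_gt0. Qed.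

Lemma powR_increment (s y : R) : 1 <= alpha -> 0 <= s -> 0 <= y ->
  (s + y) `^ alpha <=
  s `^ alpha + increment_cst * (y * s `^ (alpha - 1) + y `^ alpha).
Proof.
move=> a1 s0 y0; have c0 := ltW increment_cst_gt0.
have e0 : 0 <= alpha * expR alpha by rewrite mulr_ge0 ?expR_ge0// ltW.
case: (leP s y) => [sy|ys].
  apply: (@le_trans _ _ (increment_cst * y `^ alpha)); last first.
    rewrite mulrDr addrA lerDr addr_ge0 ?powR_ge0// mulr_ge0 ?mulr_ge0// powR_ge0//.
  apply: (@le_trans _ _ ((2 * y) `^ alpha)).
    by apply: powR_le; [exact: addr_ge0|lra].
  by rewrite powRM// ler_wpM2r ?powR_ge0// lerDl.
have sp : 0 < s := le_lt_trans y0 ys.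
set t := y / s.
have t0 : 0 <= t by rewrite divr_ge0// ltW.
have t1 : t <= 1 by rewrite ler_pdivrMr// mul1r ltW.
have tE : (1 + t) `^ alpha <= 1 + alpha * expR alpha * t.
  apply: (@le_trans _ _ (expR (t * alpha))).
    by rewrite expRM; apply: powR_le; [lra|exact: expR_ge1Dx].
  (* With u = t alpha, multiplying 1 - u <= exp(-u) by exp u gives exp u <= 1 + u exp u, and u <=
     alpha. *)
  have h := expR_ge1Dx (- (t * alpha)).
  have h2 : expR (t * alpha) * expR (- (t * alpha)) = 1 by rewrite expRN divff// expR_eq0.
  have h3 : expR (t * alpha) <= expR alpha.
    by rewrite ler_expR ler_piMl// ltW.
  have h4 := expR_gt0 (t * alpha).
  have h5 : expR (t * alpha) * (1 - t * alpha) <= 1.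
    by rewrite -[leRHS]h2 ler_wpM2l ?(ltW h4)//.
  have h6 : 0 <= t * alpha by rewrite mulr_ge0// ltW.
  have h7 : expR (t * alpha) * (t * alpha) <= expR alpha * (t * alpha) by rewrite ler_wpM2r.
  lra.
rewrite (_ : s + y = s * (1 + t));
  last by rewrite mulrDr mulr1 mulrCA divff ?gt_eqF// mulr1.
rewrite powRM//; last lra.
apply: (@le_trans _ _ (s `^ alpha * (1 + alpha * expR alpha * t))).
  by rewrite ler_wpM2l// powR_ge0.
have E : s `^ alpha * t = y * s `^ (alpha - 1).
  by rewrite -(mulr_powRB1 _ alpha_gt0)// /t mulrAC mulrCA divff ?gt_eqF// mulr1 .
rewrite mulrDr mulr1 lerD2l mulrCA E.
have h0 : 0 <= y * s `^ (alpha - 1) by rewrite mulr_ge0// powR_ge0.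
have h1 : 0 <= y `^ alpha by rewrite powR_ge0.
apply: (@le_trans _ _ (increment_cst * (y * s `^ (alpha - 1)))).
  by rewrite ler_wpM2r// lerDr powR_ge0.
by rewrite ler_wpM2l// lerDl.
Qed.

(** A weighted Young inequality, proved by comparing t with l b instead of using conjugate
    exponents. The weight l is free so that the coefficient of t^alpha can be made small. *)
Lemma powR_young (l b t : R) : 1 < alpha -> 0 < l -> 0 <= b -> 0 <= t ->
  b * t `^ (alpha - 1) <= l `^ (alpha - 1) * b `^ alpha + t `^ alpha / l.
Proof.
move=> a1 l0 b0 t0.
have a10 : 0 <= alpha - 1 by rewrite subr_ge0 ltW.
case: (leP t (l * b)) => [tlb|lbt].
  apply: (@le_trans _ _ (b * (l * b) `^ (alpha - 1))).
    by rewrite ler_wpM2l// ge0_ler_powR ?nnegrE ?mulr_ge0// ltW.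
  rewrite powRM ?(ltW l0)// mulrCA mulr_powRB1//.
  by rewrite lerDl divr_ge0 ?powR_ge0// ltW.
rewrite -(mulr_powRB1 t0 alpha_gt0).
apply: (@le_trans _ _ (t / l * t `^ (alpha - 1))).
  by rewrite ler_wpM2r ?powR_ge0// ler_pdivlMr// mulrC ltW.
by rewrite mulrAC lerDr mulr_ge0 ?powR_ge0.
Qed.

End powR_inequalities.

(** * Moments of sums of independent individuals *)

Section states.
Variable p : nat.
Implicit Types x y : state p.

Definition unit_state (i : 'I_p) : state p := [ffun j => (j == i : nat)].

Definition total (x : state p) : nat := (\sum_(i < p) x i)%N.

Lemma state_addE x y i : (x + y) i = (x i + y i)%N.
Proof. by rewrite [LHS]ffunE. Qed.

Lemma state_zeroE i : (0 : state p) i = 0%N.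
Proof. by rewrite [LHS]ffunE. Qed.

Lemma totalD x y : total (x + y) = (total x + total y)%N.
Proof. by rewrite /total -big_split/=; apply: eq_bigr => i _; rewrite state_addE. Qed.

Lemma total0 : total 0 = 0%N.
Proof. by rewrite /total big1// => i _; rewrite state_zeroE. Qed.

Lemma total_unit i : total (unit_state i) = 1%N.
Proof.
rewrite /total (bigD1 i)//= big1 ?ffunE ?eqxx// => j /negbTE ji.
by rewrite ffunE ji.
Qed.

Lemma total_eq0 x : total x = 0%N -> x = 0.
Proof.
move=> x0; apply/ffunP => i; rewrite state_zeroE; apply/eqP.
by move/eqP: x0; rewrite sum_nat_eq0 => /forallP/(_ i).
Qed.

(** Induction on the number of individuals: branching identities then need checking only at 0 and
    for one added individual. *)
Lemma state_ind (Q : state p -> Prop) :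
  Q 0 -> (forall x i, Q x -> Q (x + unit_state i)) -> forall x, Q x.
Proof.
move=> Q0 QS x; move: {2}(total x) (erefl (total x)) => n.
elim: n x => [|n IH] x xn; first by rewrite (total_eq0 xn).
have [i xi] : exists i, (0 < x i)%N.
  apply: contrapT => h; suff : x = 0 by move=> x0; rewrite x0 total0 in xn.
  apply/ffunP => i; rewrite state_zeroE; apply/eqP; rewrite -leqn0 leqNgt.
  by apply/negP => xi; apply: h; exists i.
pose y : state p := [ffun j => (x j - (j == i))%N].
have xE : x = y + unit_state i.
  apply/ffunP => j; rewrite state_addE !ffunE subnK//.
  by case: eqP => [->|].
rewrite xE; apply/QS/IH.
by have := xn; rewrite xE totalD total_unit addn1 => -[].
Qed.

Lemma norm1E (R : realType) x : norm1 R x = (total x)%:R.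
Proof. by rewrite /norm1 /total natr_sum; apply: eq_bigr => i _; rewrite ger0_norm. Qed.

End states.

Section moment_function.
Variables (R : realType) (p : nat) (alpha : R).
Hypothesis alpha_gt0 : 0 < alpha.
Local Notation S := (state p).
Implicit Types x y : S.

Lemma norm1_ge0 x : 0 <= norm1 R x.
Proof. by rewrite norm1E. Qed.

Lemma norm1D x y : norm1 R (x + y) = norm1 R x + norm1 R y.
Proof. by rewrite !norm1E totalD natrD. Qed.

Lemma norm1_0 : norm1 R (0 : S) = 0.
Proof. by rewrite norm1E total0. Qed.

Lemma norm1_unit (i : 'I_p) : norm1 R (unit_state i) = 1.
Proof. by rewrite norm1E total_unit. Qed.

Lemma norm1_ge1 x : x <> 0 -> 1 <= norm1 R x.
Proof.
by move=> x0; rewrite norm1E ler1n lt0n; apply/eqP => /total_eq0.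
Qed.

Definition moment x : \bar R := (norm1 R x `^ alpha)%:E.

Lemma moment_ge0 x : (0 <= moment x)%E.
Proof. by rewrite lee_fin powR_ge0. Qed.

Lemma moment_0 : moment 0 = 0%E.
Proof. by rewrite /moment norm1_0 powR0// gt_eqF. Qed.

Lemma moment_unit (i : 'I_p) : moment (unit_state i) = 1%E.
Proof. by rewrite /moment norm1_unit powR1. Qed.

Lemma moment_ge1 x : x <> 0 -> (1 <= moment x)%E.
Proof.
by move=> /(norm1_ge1 (x := x)) x1; rewrite lee_fin;
  have := powR_le alpha_gt0 ler01 x1; rewrite powR1.
Qed.

Lemma momentD_le x y : (moment (x + y)%R <= (2 `^ alpha)%:E * (moment x + moment y))%E.
Proof. by rewrite lee_fin norm1D powR_add_le// norm1_ge0. Qed.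

End moment_function.

(* The moment bound has an additional term, linear in the state, only when
   alpha > 1. *)
Definition linear_part (R : realType) (p : nat) (alpha : R) (x : state p) : \bar R :=
  if 1 < alpha then (norm1 R x)%:E else 0%E.

Section moment_bound.
Variables (R : realType) (p : nat) (alpha : R).
Hypothesis alpha_gt0 : 0 < alpha.
Local Notation S := (state p).
Local Open Scope ereal_scope.
Local Notation w := (@moment R p alpha).
Local Notation c := (increment_cst alpha).

Variable L : S -> (S -> \bar R) -> \bar R.
Hypothesis mL : forall x, mean_op (L x).
Hypothesis L0 : forall f : S -> \bar R, (forall x, 0 <= f x) -> L 0%R f = f 0%R.
Hypothesis LD : forall x y (f : S -> \bar R), (forall x, 0 <= f x) ->
  L (x + y)%R f = L x (fun u => L y (fun v => f (u + v)%R)).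

(** [L x] models the expectation, after a fixed number of steps without immigration, for the process
    started at x. [L0] and [LD] express that individuals evolve independently, so means add up over
    individuals. *)
Lemma mean_norm1_le (s : R) : (forall i, L (unit_state i) (fun v => (norm1 R v)%:E) <= s%:E) ->
  forall x, L x (fun v => (norm1 R v)%:E) <= (s * norm1 R x)%:E.
Proof.
move=> Ls; have n0 (x : S) : 0 <= (norm1 R x)%:E by rewrite lee_fin norm1_ge0.
apply: state_ind => [|x i IH]; first by rewrite L0// norm1_0 mulr0.
rewrite LD// norm1D mulrDr EFinD norm1_unit mulr1.
rewrite (_ : L x _ = L x (fun u => (norm1 R u)%:E) + L (unit_state i) (fun v => (norm1 R v)%:E)).
  exact: leeD.
rewrite -[X in _ + X](mean_cst (mL x)) -(meanD (mL x))//; last first.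
  by move=> _; exact: (mean_ge0 (mL _)).
congr (L x); apply/funext => u; rewrite -[X in X + _](mean_cst (mL (unit_state i))).
rewrite -(meanD (mL _))//; congr (L _); apply/funext => v.
by rewrite norm1D EFinD.
Qed.

Variables (D : set 'I_p) (s A : R).
Hypothesis s_gt0 : (0 < s)%R.
Hypothesis A_ge0 : (0 <= A)%R.
Hypothesis Ls : forall i, L (unit_state i) (fun v => (norm1 R v)%:E) <= s%:E.
Hypothesis LA : forall i, ~ D i -> L (unit_state i) w <= A%:E.

Definition avoids : set S := [set x | forall i, D i -> x i = 0%N].

Lemma avoidsD x y : avoids (x + y)%R <-> avoids x /\ avoids y.
Proof.
split=> [h|[hx hy] i Di]; last by rewrite state_addE hx ?hy.
by split=> i /h; rewrite state_addE => /eqP; rewrite addn_eq0 => /andP[/eqP ? /eqP].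
Qed.

Lemma avoids_unit i : avoids (unit_state i) -> ~ D i.
Proof. by move=> h /h; rewrite ffunE eqxx. Qed.

(** Jensen's inequality up to the factor 2: the tangent-line bound is taken at b = s norm1 x, which
    dominates the mean, so its two terms are each at most b^alpha. *)
Lemma moment_bound_small x : (alpha <= 1)%R ->
  L x w <= (2 * (s * norm1 R x) `^ alpha)%:E.
Proof.
move=> a1; have [->|/eqP x0] := eqVneq x 0%R.
  rewrite L0; last exact: moment_ge0.
  by rewrite moment_0// norm1_0 mulr0 lee_fin mulr_ge0 ?powR_ge0.
have x1 := norm1_ge1 R x0.
pose b := (s * norm1 R x)%R.
have b0 : (0 < b)%R by rewrite mulr_gt0// (lt_le_trans _ x1).
apply: (@le_trans _ _ (L x (fun v => (b `^ alpha)%:E + (b `^ (alpha - 1))%:E * (norm1 R v)%:E))).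
  apply: (mean_le (mL x)) => v; first exact: moment_ge0.
  by rewrite -EFinM -EFinD lee_fin powR_le_tangent// norm1_ge0.
have n0 (y : S) : 0 <= (norm1 R y)%:E by rewrite lee_fin norm1_ge0.
rewrite (meanD (mL x)); last 2 first.
- by move=> y; rewrite lee_fin powR_ge0.
- by move=> y; rewrite mule_ge0// lee_fin powR_ge0.
rewrite (mean_cst (mL x)) (meanZ (mL x)) ?powR_ge0//.
apply: (@le_trans _ _ ((b `^ alpha)%:E + (b `^ (alpha - 1))%:E * b%:E)).
  by apply: leeD => //; apply: lee_wpmul2l; rewrite ?lee_fin ?powR_ge0//;
    exact: mean_norm1_le.
rewrite -EFinM -EFinD lee_fin [X in (_ + X)%R]mulrC mulr_powRB1// ?(ltW b0)//.
lra.
Qed.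

(** The descendants v of the new individual are independent of the others u, so in the expansion of
    (u + v)^alpha the mixed term factors into the mean of v and the moment of order alpha - 1 of
    u. *)
Lemma moment_increment x i : (1 <= alpha)%R -> ~ D i ->
  L (x + unit_state i)%R w <=
  L x w + c%:E * (s%:E * L x (fun u => (norm1 R u `^ (alpha - 1))%:E) + A%:E).
Proof.
move=> a1 Di; have c0 := ltW (increment_cst_gt0 alpha_gt0).
have w0 := @moment_ge0 R p alpha.
have n0 (y : S) : 0 <= (norm1 R y)%:E by rewrite lee_fin norm1_ge0.
have q0 (y : S) : 0 <= (norm1 R y `^ (alpha - 1))%:E by rewrite lee_fin powR_ge0.
rewrite LD//.
rewrite -[A%:E](mean_cst (mL x)) -(meanZ (mL x)) ?(ltW s_gt0)//.
rewrite -(meanD (mL x)); last 2 first.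
- by move=> y; rewrite mule_ge0// lee_fin ltW.
- by move=> y; rewrite lee_fin.
have z0 (y : S) : 0 <= s%:E * (norm1 R y `^ (alpha - 1))%:E + A%:E.
  apply: adde_ge0; last by rewrite lee_fin.
  by apply: mule_ge0 => //; rewrite lee_fin ltW.
rewrite -(meanZ (mL x))// -(meanD (mL x)); last 2 first.
- by [].
- by move=> y; rewrite mule_ge0.
apply: (mean_le (mL x)) => u; first by apply: (mean_ge0 (mL _)).
apply: (@le_trans _ _ (L (unit_state i) (fun v =>
    w u + c%:E * ((norm1 R u `^ (alpha - 1))%:E * (norm1 R v)%:E + w v)))).
  apply: (mean_le (mL _)) => v //.
  rewrite /moment -EFinM -EFinD lee_fin norm1D.
  by rewrite (mulrC (norm1 R u `^ _)%R) powR_increment// norm1_ge0.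
have z1 v : 0 <= (norm1 R u `^ (alpha - 1))%:E * (norm1 R v)%:E + w v.
  by rewrite adde_ge0// mule_ge0.
rewrite (meanD (mL _)); last 2 first.
- by [].
- by move=> v; rewrite mule_ge0.
rewrite (mean_cst (mL _)) leeD2l// (meanZ (mL _))//.
rewrite lee_wpmul2l ?lee_fin// (meanD (mL _)); last 2 first.
- by move=> v; rewrite mule_ge0.
- by [].
apply: leeD; last exact: LA.
rewrite (meanZ (mL _)) ?powR_ge0//.
by rewrite muleC lee_wpmul2r.
Qed.

(** The moment of order alpha - 1 in [moment_increment] is traded by Young's inequality for the
    moment a of order alpha. The weight l = 2c leaves just a/(2m) per added individual, and at most
    m individuals are added. *)
Lemma moment_bound_large x : (1 < alpha)%R -> avoids x ->
  L x w <= ((2 * c) `^ alpha * (s * norm1 R x) `^ alpha + 2 * c * A * norm1 R x)%:E.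
Proof.
move=> a1 Zx.
have c0 := increment_cst_gt0 alpha_gt0.
have w0 := @moment_ge0 R p alpha.
have [->|/eqP x0] := eqVneq x 0%R.
  rewrite L0// moment_0// norm1_0 !mulr0 addr0.
  by rewrite lee_fin mulr_ge0 ?powR_ge0.
have m1 := norm1_ge1 R x0; set m := norm1 R x in m1 *.
have m0 : (0 < m)%R by rewrite (lt_le_trans _ m1).
pose l := (2 * c)%R.
have l0 : (0 < l)%R by rewrite mulr_gt0.
pose E := (c * (l `^ (alpha - 1) * (m * s) `^ alpha) + m * c * A)%R.
have E0 : (0 <= E)%R by rewrite addr_ge0 ?mulr_ge0 ?powR_ge0 ?(ltW m0) ?(ltW c0).
(* Induction on y with a slope 2E/m: each individual adds at most
   a/(2m) + E/m, and a/(2m) <= E/m as long as norm1 y <= m. *)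
suff H y : avoids y -> (norm1 R y <= m)%R -> L y w <= (2 * norm1 R y / m * E)%:E.
  apply: (le_trans (H x Zx (lexx _))); rewrite lee_fin -/m.
  rewrite mulfK ?gt_eqF// /E mulrDr [leLHS]addrC [leRHS]addrC.
  apply: lerD; first by lra.
  rewrite mulrA mulrA mulr_powRB1 ?(ltW l0)// (mulrC m).
  exact: lexx.
move: y; apply: state_ind => [_ _|y i IH].
  by rewrite L0// moment_0// norm1_0 mulr0 !mul0r.
rewrite avoidsD norm1D norm1_unit => -[Zy /avoids_unit Di] ym.
have ym' : (norm1 R y <= m)%R by rewrite (le_trans _ ym)// lerDl.
have {}IH := IH Zy ym'.
apply: (le_trans (moment_increment _ (ltW a1) Di)).
have q0 (z : S) : 0 <= (norm1 R z `^ (alpha - 1))%:E by rewrite lee_fin powR_ge0.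
have Y : (m * s)%:E * L y (fun u => (norm1 R u `^ (alpha - 1))%:E) <=
    (l `^ (alpha - 1) * (m * s) `^ alpha)%:E + (l^-1)%:E * L y w.
  have ms0 : (0 <= m * s)%R by rewrite mulr_ge0 ?ltW.
  rewrite -(meanZ (mL y))// -(meanZ (mL y)) ?invr_ge0 ?(ltW l0)//.
  rewrite -[X in _ <= X + _](mean_cst (mL y)) -(meanD (mL y)); last 2 first.
  - by move=> _; rewrite lee_fin mulr_ge0 ?powR_ge0.
  - by move=> z; rewrite mule_ge0// lee_fin invr_ge0 ltW.
  apply: (mean_le (mL y)) => z; first by rewrite mule_ge0.
  rewrite /moment -!EFinM -EFinD lee_fin (mulrC l^-1%R).
  by rewrite powR_young// norm1_ge0.
(* Both moments must be finite before real arithmetic can be used: that of order alpha by induction,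
   that of order alpha - 1 by [Y], as m s > 0. *)
have Lfin : L y w \is a fin_num.
  by rewrite ge0_fin_numE; [exact: (le_lt_trans IH (ltry _))|exact: (mean_ge0 (mL y))].
have Qfin : L y (fun u => (norm1 R u `^ (alpha - 1))%:E) \is a fin_num.
  rewrite ge0_fin_numE; last exact: (mean_ge0 (mL y)).
  rewrite -(@lte_pmul2l _ (m * s)%:E) ?lte_fin ?mulr_gt0//.
  rewrite gt0_muley ?lte_fin ?mulr_gt0//; apply: (le_lt_trans Y).
  by rewrite -(fineK Lfin) -EFinM -EFinD ltry.
move: IH Y; rewrite -(fineK Lfin) -(fineK Qfin) -!EFinM -!EFinD !lee_fin.
set a := fine _; set q := fine _ => IH Y.
have mc : (0 <= c / m)%R by rewrite divr_ge0 ?ltW.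
have h1 : (c * (s * q + A) <= c / m * (l `^ (alpha - 1) * (m * s) `^ alpha + l^-1 * a) + c * A)%R.
  rewrite mulrDr lerD2r.
  rewrite (_ : c * (s * q) = c / m * (m * s * q))%R; last by field; rewrite gt_eqF.
  exact: ler_wpM2l.
apply: (le_trans (lerD (lexx a) h1)).
rewrite (_ : c / m * _ + c * A = E / m + c / m * (l^-1 * a))%R; last first.
  by rewrite /E; field; rewrite !gt_eqF.
rewrite (_ : c / m * (l^-1 * a) = a / (2 * m))%R; last first.
  by rewrite /l; field; rewrite !gt_eqF.
rewrite (_ : (2 * (norm1 R y + 1) / m * E = 2 * norm1 R y / m * E + E / m + E / m)%R);
  last by ring.
have h2 : (a / (2 * m) <= E / m)%R.
  rewrite ler_pdivrMr ?mulr_gt0//.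
  rewrite (_ : E / m * (2 * m) = 2 * E)%R; last by field; rewrite gt_eqF.
  apply: (le_trans IH); rewrite -mulrA -mulrA; apply: ler_wpM2l => //.
  rewrite mulrA; apply: ler_piMl => //.
  by rewrite ler_pdivrMr// mul1r.
by apply: (le_trans (lerD IH (lerD (lexx (E / m)%R) h2))); rewrite addrA.
Qed.

(** The summand 2 comes from the case alpha <= 1, the other from alpha > 1; their sum covers
    both. *)
Definition moment_cst : R := (2 + (2 * c) `^ alpha)%R.

Lemma moment_bound x : avoids x ->
  L x w <= (moment_cst * s `^ alpha)%:E * w x +
           (2 * c * A)%:E * linear_part alpha x.
Proof.
move=> Zx; rewrite /linear_part.
have -> : (moment_cst * s `^ alpha)%:E * w x = (moment_cst * (s * norm1 R x) `^ alpha)%:E.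
  by rewrite powRM ?norm1_ge0 ?(ltW s_gt0)// /moment -EFinM mulrA.
rewrite /moment_cst.
have ps := powR_ge0 (s * norm1 R x)%R alpha.
have pc := powR_ge0 (2 * c)%R alpha.
case: ltP => [a1|a1].
  apply: (le_trans (moment_bound_large a1 Zx)); rewrite -EFinM -EFinD lee_fin.
  rewrite lerD2r ler_wpM2r// lerDr//.
rewrite mule0 adde0; apply: (le_trans (moment_bound_small x a1)).
by rewrite lee_fin ler_wpM2r// lerDl.
Qed.

End moment_bound.

(** * Iterated kernels with the branching property *)

Section branching.
Variables (R : realType) (p : nat).
Local Notation S := (state p).
Local Open Scope ereal_scope.

Lemma iter_kernel_ge0 (k : S -> probability S R) n (f : S -> \bar R) x :
  (forall y, 0 <= f y) -> 0 <= iter n (kernel_op k) f x.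
Proof. exact: (mean_ge0 (mean_op_iter k n x)). Qed.

(** In the induction, the first step of the y-part has to be moved out of the remaining n steps of
    the x-part; [mean_exchange] is this Fubini step. Immigration, if any, is carried by [k], that
    is, by the x-part only. *)
Lemma iter_branching (k b : S -> probability S R) :
  (forall x y (f : S -> \bar R), (forall z, 0 <= f z) ->
    kernel_op k f (x + y)%R =
    kernel_op k (fun u => kernel_op b (fun v => f (u + v)%R) y) x) ->
  forall n x y (f : S -> \bar R), (forall z, 0 <= f z) ->
    iter n (kernel_op k) f (x + y)%R =
    iter n (kernel_op k) (fun u => iter n (kernel_op b) (fun v => f (u + v)%R) y) x.
Proof.
move=> kD; elim=> [//|n IH] x y f f0 /=.
rewrite kD; last by move=> z; exact: iter_kernel_ge0.
apply: eq_integral => u _.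
rewrite [RHS](mean_exchange (mean_op_iter k n u)); last first.
  by move=> u' v; exact: iter_kernel_ge0.
by apply: eq_integral => v _; rewrite IH.
Qed.

Lemma iter_kernel0 (b : S -> probability S R) :
  (forall f : S -> \bar R, (forall x, 0 <= f x) -> kernel_op b f 0%R = f 0%R) ->
  forall n (f : S -> \bar R), (forall x, 0 <= f x) ->
    iter n (kernel_op b) f 0%R = f 0%R.
Proof.
move=> b0 n f f0; elim: n => //= n IH; rewrite b0 ?IH// => x.
exact: iter_kernel_ge0.
Qed.

End branching.

(** * First moments as powers of the mean matrix *)

Definition coordinate (R : realType) (p : nat) (j : 'I_p) (x : state p) : \bar R :=
  (x j)%:R%:E.

Section first_moments.
Variables (R : realType) (p : nat).
Local Notation S := (state p).
Local Open Scope ereal_scope.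
Variable b : S -> probability S R.
Local Notation B := (kernel_op b).
Hypothesis B0 : forall f : S -> \bar R, (forall x, 0 <= f x) -> B f 0%R = f 0%R.
Hypothesis BD : forall x y (f : S -> \bar R), (forall z, 0 <= f z) ->
  B f (x + y)%R = B (fun u => B (fun v => f (u + v)%R) y) x.
Variable M : 'M[R]_p.
Hypothesis BM : forall i j, B (coordinate R j) (unit_state i) = (M i j)%:E.

Lemma coordinate_ge0 j (x : S) : 0 <= coordinate R j x.
Proof. by rewrite lee_fin. Qed.

Lemma mean_matrix_ge0 i j : (0 <= M i j)%R.
Proof. by rewrite -lee_fin -BM; apply: integral_ge0 => x _; exact: coordinate_ge0. Qed.

Lemma sum_unit_state (F : 'I_p -> R) i :
  (\sum_(l < p) (unit_state i l)%:R * F l = F i)%R.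
Proof.
rewrite (bigD1 i)//= ffunE eqxx mul1r big1 ?addr0// => l /negbTE li.
by rewrite ffunE li mul0r.
Qed.

Lemma kernel_coordinate j x :
  B (coordinate R j) x = (\sum_(i < p) (x i)%:R * M i j)%R%:E.
Proof.
elim/state_ind: x => [|x i IH].
  rewrite B0; last exact: coordinate_ge0.
  rewrite /coordinate state_zeroE big1// => i _.
  by rewrite state_zeroE mul0r.
rewrite BD; last exact: coordinate_ge0.
rewrite (_ : B _ x = B (coordinate R j) x + B (coordinate R j) (unit_state i)).
  rewrite IH BM -EFinD; congr EFin.
  under [RHS]eq_bigr do rewrite state_addE natrD mulrDl.
  rewrite big_split/=; congr (_ + _)%R.
  rewrite (bigD1 i)//= ffunE eqxx mul1r big1 ?addr0// => l /negbTE li.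
  by rewrite ffunE li mul0r.
have mL y := mean_op_integral (b y).
rewrite -[X in _ + X](mean_cst (mL x)) -(meanD (mL x)); last 2 first.
- exact: coordinate_ge0.
- by move=> _; apply: (mean_ge0 (mL _)); exact: coordinate_ge0.
apply: eq_integral => u _.
rewrite -[X in X + _](mean_cst (mL (unit_state i))) -(meanD (mL _)); last 2 first.
- by move=> _; exact: coordinate_ge0.
- exact: coordinate_ge0.
by apply: eq_integral => v _; rewrite /coordinate state_addE natrD EFinD.
Qed.

Lemma iter_coordinate n j x :
  iter n B (coordinate R j) x = (\sum_(i < p) (x i)%:R * (M ^+ n) i j)%R%:E.
Proof.
elim: n x => [|n IH] x /=.
  rewrite (bigD1 j)//= expr0 mxE eqxx mulr1 big1 ?addr0// => i /negbTE ij.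
  by rewrite mxE ij mulr0.
have Mn0 i : (0 <= (M ^+ n) i j)%R.
  rewrite -(sum_unit_state (fun l => (M ^+ n)%R l j)) -lee_fin -IH.
  by apply: iter_kernel_ge0 => y; exact: coordinate_ge0.
transitivity (B (fun y => \sum_(i < p) ((M ^+ n) i j)%:E * coordinate R i y) x).
  apply: eq_integral => y _; rewrite IH sumEFin -?EFinM; congr EFin.
  by apply: eq_bigr => i _; rewrite mulrC.
have mL := mean_op_integral (b x).
rewrite /kernel_op (mean_sum mL)/=; last by move=> i y;
  rewrite mule_ge0// ?lee_fin// coordinate_ge0.
under eq_bigr => i _.
  rewrite ge0_integralZl_EFin//; last by move=> y _; exact: coordinate_ge0.
  rewrite -/(kernel_op b (coordinate R i) x) kernel_coordinate -EFinM.
  over.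
rewrite sumEFin; congr EFin.
transitivity (\sum_(i < p) \sum_(l < p) (M ^+ n) i j * ((x l)%:R * M l i))%R.
  by apply: eq_bigr => i _; rewrite mulr_sumr.
rewrite exchange_big/=; apply: eq_bigr => i _.
rewrite exprS mxE mulr_sumr; apply: eq_bigr => l _.
ring.
Qed.

Lemma iter_norm1 n x :
  iter n B (fun y => (norm1 R y)%:E) x =
  (\sum_(i < p) (x i)%:R * \sum_(j < p) (M ^+ n) i j)%R%:E.
Proof.
have mL := mean_op_iter b n x.
transitivity (iter n B (fun y => \sum_(j < p) coordinate R j y) x).
  congr (iter n B _ x); apply/funext => y.
  by rewrite sumEFin norm1E /total natr_sum.
rewrite (mean_sum mL); last by move=> j y; exact: coordinate_ge0.
under eq_bigr do rewrite iter_coordinate.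
rewrite sumEFin; congr EFin.
by rewrite exchange_big/=; apply: eq_bigr => i _; rewrite mulr_sumr.
Qed.

Hypothesis Mcvg : forall i j, (M ^+ n)%R i j @[n --> \oo] --> (0 : R)%R.

Lemma iter_norm1_cvg x :
  (\sum_(i < p) (x i)%:R * \sum_(j < p) (M ^+ n) i j)%R @[n --> \oo] --> (0 : R)%R.
Proof.
rewrite [X in _ --> X](_ : 0%R = \sum_(i < p) (x i)%:R * \sum_(j < p) 0)%R; last first.
  by rewrite big1// => i _; rewrite big1 ?mulr0.
apply: cvg_big => [|i _]; first exact: add_continuous.
apply: cvgM; first exact: cvg_cst.
by apply: cvg_big => [|j _]; [exact: add_continuous|exact: Mcvg].
Qed.

Lemma iter_norm1_unit_small (s : R) : (0 < s)%R ->
  exists2 n, (0 < n)%N &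
    forall i, iter n B (fun y => (norm1 R y)%:E) (unit_state i) <= s%:E.
Proof.
move=> s0; have H i : \forall n \near \oo,
    (\sum_(l < p) (unit_state i l)%:R * \sum_(j < p) (M ^+ n) l j < s)%R.
  apply: (cvgr_lt 0%R) => //; exact: iter_norm1_cvg.
have : \forall n \near \oo, forall i,
    (\sum_(l < p) (unit_state i l)%:R * \sum_(j < p) (M ^+ n) l j < s)%R.
  exact: filter_forall.
(* The successor makes the time positive, as it later serves as a period to divide by. *)
move=> [n _ Hn]; exists n.+1 => // i.
by rewrite iter_norm1 lee_fin ltW// Hn//= .
Qed.

Lemma survival_le n x :
  iter n B (fun y => (\1_(~` [set 0%R]) y)%:E) x <=
  (\sum_(i < p) (x i)%:R * \sum_(j < p) (M ^+ n) i j)%R%:E.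
Proof.
rewrite -iter_norm1; apply: (mean_le (mean_op_iter b n x)) => y.
  by rewrite lee_fin.
rewrite lee_fin indicE; case: (boolP (y \in _)) => [|_]; last exact: norm1_ge0.
by rewrite inE => y0; exact: norm1_ge1.
Qed.

End first_moments.

(** * Geometric decay of moments without immigration *)

Section absorbing.
Variables (R : realType) (p : nat) (D : set 'I_p).
Local Notation S := (state p).
Local Open Scope ereal_scope.
Local Notation dead := (fun x : S => (\1_(~` avoids D) x)%:E : \bar R).
Variable k : S -> probability S R.
Local Notation K := (kernel_op k).
Hypothesis k_dead : forall x, avoids D x -> K dead x = 0.

Lemma iter_dead n x : avoids D x -> iter n K dead x = 0.
Proof.
(* Stated for all x, including those meeting [D], where the trivial bound 1 is enough; this makes
   the induction pass. *)
have H : forall x, iter n K dead x <= dead x.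
  elim: n => [//|n IH] {}x /=.
  have [Zx|Zx] := pselect (avoids D x).
    rewrite indicE memNset//=.
    apply: (@le_trans _ _ (K dead x)); last by rewrite k_dead.
    apply: (mean_le (mean_op_integral (k x))) => // y.
    by apply: iter_kernel_ge0 => z; rewrite lee_fin.
  rewrite indicE mem_set//= -[leRHS](mean_cst (mean_op_iter k n.+1 x)).
  by apply: (mean_le (mean_op_iter k n.+1 x)) => y; rewrite lee_fin// indicE;
    case: (_ \in _).
move=> Zx; apply/eqP; rewrite eq_le iter_kernel_ge0 ?andbT; last by move=> y;
  rewrite lee_fin.
by rewrite (le_trans (H x))// indicE memNset.
Qed.

Lemma iter_le_avoids n x (f g : S -> \bar R) : avoids D x ->
  (forall y, 0 <= f y) -> (forall y, 0 <= g y) ->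
  (forall y, avoids D y -> f y <= g y) -> iter n K f x <= iter n K g x.
Proof.
move=> Zx f0 g0 fg; apply: (mean_le_ae (mean_op_iter k n x) (iter_dead n Zx)) => // y.
by move=> /contrapT; exact: fg.
Qed.

End absorbing.

Section moment_decay.
Variables (R : realType) (p : nat) (alpha : R).
Hypothesis alpha_gt0 : 0 < alpha.
Local Notation S := (state p).
Local Open Scope ereal_scope.
Local Notation w := (@moment R p alpha).
Local Notation lin := (@linear_part R p alpha).
Local Notation c := (increment_cst alpha).
Variable b : S -> probability S R.
Local Notation B := (kernel_op b).
Hypothesis B0 : forall f : S -> \bar R, (forall x, 0 <= f x) -> B f 0%R = f 0%R.
Hypothesis BD : forall x y (f : S -> \bar R), (forall z, 0 <= f z) ->
  B f (x + y)%R = B (fun u => B (fun v => f (u + v)%R) y) x.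
Variable M : 'M[R]_p.
Hypothesis BM : forall i j, B (coordinate R j) (unit_state i) = (M i j)%:E.
Hypothesis Mcvg : forall i j, (M ^+ n)%R i j @[n --> \oo] --> (0 : R)%R.
Variable D : set 'I_p.
Hypothesis MD : forall i j, ~ D i -> D j -> M i j = 0%R.
Hypothesis Bw : forall i, ~ D i -> B w (unit_state i) < +oo.
Local Notation dead := (fun x : S => (\1_(~` avoids D) x)%:E).

Let mB n x := mean_op_iter b n x.
Let w0 := @moment_ge0 R p alpha.

Lemma linear_part_ge0 x : 0 <= lin x.
Proof. by rewrite /linear_part; case: ifP => // _; rewrite lee_fin norm1_ge0. Qed.

Lemma linear_part_le x : lin x <= w x.
Proof.
rewrite /linear_part; case: ltP => // a1.
have [->|/eqP x0] := eqVneq x 0%R; first by rewrite norm1_0 w0.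
by rewrite lee_fin le1r_powR// ?norm1_ge1// ltW.
Qed.

(** The mean number of children of each type in [D] is zero, and the indicator is at most the sum of
    these counts. *)
Lemma kernel_dead x : avoids D x -> B dead x = 0.
Proof.
move=> Zx; apply/eqP; rewrite eq_le integral_ge0 ?andbT; last by move=> *;
  rewrite lee_fin.
have mL := mean_op_integral (b x).
apply: (@le_trans _ _ (B (fun y => \sum_(j < p) (if `[< D j >] then coordinate R j y else 0)) x)).
  apply: (mean_le mL) => y; first by rewrite lee_fin.
  rewrite indicE; case: (boolP (y \in _)) => [|_]; last first.
    by apply: sume_ge0 => j _; case: ifP => // _; exact: coordinate_ge0.
  rewrite inE => /existsNP [j /not_implyP [Dj /eqP yj]].
  rewrite (bigD1 j)//= asboolT//.
  apply: (@le_trans _ _ (coordinate R j y)); first by rewrite lee_fin ler1n lt0n.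
  by rewrite leeDl// sume_ge0// => i _; case: ifP => // _; exact: coordinate_ge0.
rewrite /kernel_op (mean_sum mL)/=; last first.
  by move=> j y; case: ifP => // _; exact: coordinate_ge0.
rewrite big1// => j _; case: asboolP => Dj; last by rewrite integral0.
rewrite -/(kernel_op b (coordinate R j) x) (kernel_coordinate B0 BD BM).
rewrite big1// => i _; have [Di|Di] := pselect (D i); first by rewrite Zx// mul0r.
by rewrite MD// mulr0.
Qed.

Lemma iter_moment_bound n (s A : R) x : (0 < s)%R -> (0 <= A)%R ->
  (forall i, iter n B (fun v => (norm1 R v)%:E) (unit_state i) <= s%:E) ->
  (forall i, ~ D i -> iter n B w (unit_state i) <= A%:E) -> avoids D x ->
  iter n B w x <= (moment_cst alpha * s `^ alpha)%:E * w x + (2 * c * A)%:E * lin x.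
Proof.
move=> s0 A0 Hs HA;
  apply: (@moment_bound R p alpha alpha_gt0 (fun x f => iter n B f x)) => //.
  by move=> f f0; exact: iter_kernel0.
by move=> y z f f0; exact: iter_branching.
Qed.

Lemma iter_linear_part n (s : R) x : (0 < s)%R ->
  (forall i, iter n B (fun v => (norm1 R v)%:E) (unit_state i) <= s%:E) ->
  iter n B lin x <= s%:E * lin x.
Proof.
move=> s0 Hs; rewrite /linear_part; case: ifP => a1;
  last by rewrite mule0 (mean_cst (mB n x)).
rewrite -EFinM; apply: (@mean_norm1_le R p (fun x f => iter n B f x)) => //.
  by move=> f f0; exact: iter_kernel0.
by move=> y z f f0; exact: iter_branching.
Qed.

(** A crude bound without contraction. It supplies the finite constant at the time N chosen in
    [moment_decay] and controls the fewer than N steps left over there. *)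
Lemma kernel_moment_growth : exists2 c1 : R, (1 <= c1)%R &
  forall n x, avoids D x -> iter n B w x <= (c1 ^+ n)%:E * w x.
Proof.
have M0 := mean_matrix_ge0 BM.
pose s : R := (1 + \sum_i \sum_j M i j)%R.
have s0 : (0 < s)%R by rewrite ltr_pwDl// sumr_ge0// => i _; rewrite sumr_ge0.
pose A : R := (\sum_i fine (B w (unit_state i)))%R.
have Bw0 i : 0 <= B w (unit_state i) by apply: integral_ge0.
have A0 : (0 <= A)%R by rewrite sumr_ge0// => i _; rewrite fine_ge0.
have c0 := increment_cst_gt0 alpha_gt0.
have H x : avoids D x ->
    B w x <= (moment_cst alpha * s `^ alpha)%:E * w x + (2 * c * A)%:E * lin x.
  apply: (@iter_moment_bound 1) => // i.
    rewrite (iter_norm1 B0 BD BM) sum_unit_state lee_fin expr1.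
    rewrite /s [X in (_ <= 1 + X)%R](bigD1 i)//= addrCA lerDl addr_ge0// sumr_ge0// => l _.
    by rewrite sumr_ge0.
  move=> Di; apply: (@le_trans _ _ (fine (B w (unit_state i)))%:E).
    by rewrite fineK// ge0_fin_numE// Bw.
  by rewrite lee_fin /A (bigD1 i)//= lerDl sumr_ge0// => l _; rewrite fine_ge0.
have m0 : (0 <= moment_cst alpha * s `^ alpha :> R)%R.
  by rewrite mulr_ge0 ?powR_ge0// addr_ge0 ?powR_ge0.
have cA0 : (0 <= 2 * c * A)%R by rewrite !mulr_ge0// ltW.
pose c1 := (1 + moment_cst alpha * s `^ alpha + 2 * c * A)%R.
have c10 : (0 <= c1)%R by rewrite !addr_ge0.
exists c1; first by rewrite /c1 -addrA lerDl addr_ge0.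
elim=> [|n IH] x Zx; first by rewrite expr0 mul1e.
rewrite /=; apply: (@le_trans _ _ (B (fun y => (c1 ^+ n)%:E * w y) x)).
  apply: (@iter_le_avoids _ _ _ _ kernel_dead 1) => // y; first exact: iter_kernel_ge0.
  by rewrite mule_ge0// lee_fin exprn_ge0.
rewrite [leLHS](meanZ (mean_op_integral (b x))) ?exprn_ge0//.
rewrite exprSr EFinM -muleA lee_wpmul2l ?lee_fin ?exprn_ge0//.
apply: (le_trans (H x Zx)).
have lf : lin x \is a fin_num by rewrite /linear_part; case: ifP.
have := linear_part_le x; rewrite /moment -(fineK lf) -!EFinM -EFinD !lee_fin /c1.
set a := (_ `^ alpha)%R; set f := fine _; set m := (_ * _)%R in m0 *;
  set k := (2 * c * A)%R in cA0 *.
move=> fa; have := ler_wpM2l cA0 fa.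
have : (0 <= a)%R by exact: powR_ge0.
lra.
Qed.

Theorem moment_decay : exists C theta : R,
  [/\ (0 < C)%R, (0 < theta < 1)%R &
   forall n x, avoids D x -> iter n B w x <= (C * theta ^+ n)%:E * w x].
Proof.
have [c1 c1_ge1 Hc1] := kernel_moment_growth.
have c10 : (0 <= c1)%R by rewrite (le_trans _ c1_ge1).
have c0 := increment_cst_gt0 alpha_gt0.
have m0 : (0 < moment_cst alpha :> R)%R by rewrite ltr_pwDl// powR_ge0.
(* The two entries of the minimum ensure that the linear part contracts by 1/4 and that the leading
   coefficient [moment_cst alpha * s ^ alpha] is at most 1/2. *)
pose s : R := (Num.min (4^-1) ((2 * moment_cst alpha)^-1 `^ alpha^-1))%R.
have s0 : (0 < s)%R by rewrite lt_min invr_gt0 ltr0n powR_gt0 ?invr_gt0 ?mulr_gt0.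
have s4 : (s <= 4^-1)%R by rewrite ge_min lexx.
have sa : (moment_cst alpha * s `^ alpha <= 2^-1)%R.
  apply: (@le_trans _ _ (moment_cst alpha * (2 * moment_cst alpha)^-1)%R).
    rewrite ler_wpM2l ?(ltW m0)//.
    apply: (@le_trans _ _ (((2 * moment_cst alpha)^-1 `^ alpha^-1) `^ alpha)%R).
      by apply: powR_le => //; [exact: ltW|rewrite ge_min lexx orbT].
    by rewrite -powRrM mulVf ?gt_eqF// powRr1// invr_ge0 mulr_ge0 ?ltW.
  by rewrite invfM mulrCA divff ?gt_eqF// mulr1.
have [N N0 HN] := iter_norm1_unit_small B0 BD BM Mcvg s0.
pose A := (c1 ^+ N)%R.
have A0 : (0 <= A)%R by rewrite exprn_ge0.
(* The linear term produced by the moment bound is then one quarter of [cc * lin]; with the quarter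
   left by the contraction of [lin], [V] is halved over N steps. *)
pose cc := (4 * (2 * c * A))%R.
have cc0 : (0 <= cc)%R by rewrite !mulr_ge0// ltW.
pose V x := w x + cc%:E * lin x.
have V0 x : 0 <= V x by rewrite adde_ge0 ?w0// mule_ge0 ?lee_fin// linear_part_ge0.
have lfin x : lin x \is a fin_num by rewrite /linear_part; case: ifP.
have l0 := linear_part_ge0.
have NV x : avoids D x -> iter N B V x <= (2^-1)%:E * V x.
  move=> Zx; rewrite (meanD (mB N x)) ?(meanZ (mB N x))//; last by move=> y;
    rewrite mule_ge0.
  have HA i : ~ D i -> iter N B w (unit_state i) <= A%:E.
    move=> Di; apply: (le_trans (Hc1 _ _ _)); last by rewrite moment_unit mule1.
    by move=> j Dj; rewrite ffunE; case: eqP => // ji; case: Di; rewrite -ji.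
  have h1 := iter_moment_bound s0 A0 HN HA Zx.
  have h2 : cc%:E * iter N B lin x <= cc%:E * (s%:E * lin x).
    by rewrite lee_wpmul2l ?lee_fin// iter_linear_part.
  apply: (le_trans (leeD h1 h2)).
  rewrite /V /moment -(fineK (lfin x)) -!EFinM -!EFinD -?EFinM lee_fin.
  have f0 : (0 <= fine (lin x))%R by rewrite fine_ge0.
  have wr0 := powR_ge0 (norm1 R x) alpha.
  set a := (norm1 R x `^ alpha)%R in wr0 *; set f := fine _ in f0 *.
  have e1 : (moment_cst alpha * s `^ alpha * a <= 2^-1 * a)%R by rewrite ler_wpM2r.
  have e2 : (s * f <= 4^-1 * f)%R by rewrite ler_wpM2r.
  have e3 : (cc * (s * f) <= cc * (4^-1 * f))%R by rewrite ler_wpM2l.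
  have e4 : (2 * c * A * f = 4^-1 * cc * f)%R by rewrite /cc; field.
  rewrite e4; lra.
have qNV q x : avoids D x -> iter (q * N) B V x <= (2^-1 ^+ q)%:E * V x.
  move=> Zx; elim: q => [|q IH]; first by rewrite mul0n expr0 mul1e.
  rewrite mulSn addnC iterD.
  apply: (@le_trans _ _ (iter (q * N) B (fun y => (2^-1)%:E * V y) x)).
    apply: (iter_le_avoids kernel_dead) => // y; first exact: iter_kernel_ge0.
    by rewrite mule_ge0// lee_fin invr_ge0.
  rewrite (meanZ (mB _ x)) ?invr_ge0// exprS EFinM -muleA.
  by rewrite lee_wpmul2l// lee_fin invr_ge0.
(* Halving over N steps means a rate 2^(-1/N) per step. The factor 2 in the final constant pays for
   the remainder r < N, for which theta^r >= 1/2. *)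
pose theta : R := (2^-1 `^ N%:R^-1)%R.
have N0' : (N%:R != 0 :> R)%R by rewrite pnatr_eq0 -lt0n.
have tN : (theta ^+ N = 2^-1)%R.
  by rewrite -powR_mulrn ?powR_ge0// -powRrM mulVf// powRr1// invr_ge0.
have t0 : (0 < theta)%R by rewrite powR_gt0// invr_gt0.
have t1 : (theta < 1)%R.
  rewrite ltNge; apply/negP => t1; have := exprn_ege1 N t1; rewrite tN.
  lra.
have C0 : (0 < 2 * (A * (1 + cc)))%R.
  by rewrite !mulr_gt0// ?exprn_gt0 ?(lt_le_trans _ c1_ge1)// ltr_pwDl.
exists (2 * (A * (1 + cc)))%R, theta; split; rewrite ?t0//.
move=> n x Zx; rewrite (divn_eq n N) iterD; set q := (n %/ N)%N; set r := (n %% N)%N.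
have rN : (r < N)%N by rewrite ltn_mod.
apply: (@le_trans _ _ (iter (q * N) B (fun y => A%:E * V y) x)).
  apply: (iter_le_avoids kernel_dead) => // y; first exact: iter_kernel_ge0.
    by rewrite mule_ge0// lee_fin.
  move=> Zy; apply: (le_trans (Hc1 r y Zy)); apply: (@le_trans _ _ (A%:E * w y)).
    by rewrite lee_wpmul2r// lee_fin ler_weXn2l// ltnW.
  by rewrite lee_wpmul2l ?lee_fin// leeDl// mule_ge0.
rewrite (meanZ (mB _ x))//.
apply: (@le_trans _ _ (A%:E * ((2^-1 ^+ q)%:E * ((1 + cc)%:E * w x)))).
  rewrite lee_wpmul2l ?lee_fin//; apply: (le_trans (qNV q x Zx)).
  rewrite lee_wpmul2l ?lee_fin ?exprn_ge0// ?invr_ge0//.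
  have := linear_part_le x; rewrite /V /moment -(fineK (lfin x)) -!EFinM -EFinD !lee_fin.
  by move=> fa; have := ler_wpM2l cc0 fa; lra.
rewrite /moment -!EFinM lee_fin !mulrA ler_wpM2r ?powR_ge0// exprD mulnC exprM tN.
have h : (2^-1 <= theta ^+ r)%R by rewrite -tN ler_wiXn2l ?(ltW t0) ?(ltW t1) ?(ltnW rN).
have e : (0 <= A * (1 + cc) * 2^-1 ^+ q)%R.
  by rewrite !mulr_ge0 ?exprn_ge0 ?invr_ge0// addr_ge0.
have := ler_wpM2l e h; lra.
Qed.

End moment_decay.

(** * Immigration and stationary distributions *)

Section immigration.
Variables (R : realType) (p : nat).
Local Notation S := (state p).
Local Open Scope ereal_scope.
Variables (b k : S -> probability S R) (h : probability S R).
Local Notation B := (kernel_op b).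
Local Notation K := (kernel_op k).
Hypothesis B0 : forall f : S -> \bar R, (forall x, 0 <= f x) -> B f 0%R = f 0%R.
Hypothesis BD : forall x y (f : S -> \bar R), (forall z, 0 <= f z) ->
  B f (x + y)%R = B (fun u => B (fun v => f (u + v)%R) y) x.
Hypothesis KE : forall x (f : S -> \bar R), (forall z, 0 <= f z) ->
  K f x = B (fun u => \int[h]_v f (u + v)%R) x.

Lemma kernel_immigration_add x y (f : S -> \bar R) : (forall z, 0 <= f z) ->
  K f (x + y)%R = K (fun u => B (fun v => f (u + v)%R) y) x.
Proof.
move=> f0; rewrite !KE//; [|by move=> z; apply: integral_ge0..].
rewrite BD; last by move=> z; apply: integral_ge0.
apply: eq_integral => u _.
rewrite [LHS]integral_state_exchange//.
apply: eq_integral => v _; apply: eq_integral => z _.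
by rewrite addrAC.
Qed.

Lemma kernel_immigration0 (f : S -> \bar R) : (forall z, 0 <= f z) ->
  K f 0%R = \int[h]_v f v.
Proof.
move=> f0; rewrite KE// B0; last by move=> z; apply: integral_ge0.
by under eq_integral do rewrite add0r.
Qed.

(** All immigration is assigned to the part u started at 0; v is the independent progeny of x. Every
    comparison of starting points below goes through this decomposition. *)
Lemma iter_immigration n x (f : S -> \bar R) : (forall z, 0 <= f z) ->
  iter n K f x = iter n K (fun u => iter n B (fun v => f (u + v)%R) x) 0%R.
Proof.
by move=> f0; rewrite -{1}(add0r x); apply: (iter_branching kernel_immigration_add).
Qed.

(** Monotonicity for the componentwise order, written with addition because starting states and
    immigrants enter the branching identities as summands. *)
Definition increasing (f : S -> \bar R) :=
  (forall x, 0 <= f x) /\ forall x y, f x <= f (x + y)%R.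

Lemma increasing_r (f : S -> \bar R) x y : increasing f -> f y <= f (x + y)%R.
Proof. by rewrite addrC => -[]. Qed.

Lemma iter_increasing_l n x (f : S -> \bar R) : increasing f ->
  iter n K f 0%R <= iter n K f x.
Proof.
move=> [f0 fi]; rewrite [leRHS]iter_immigration//; apply: (mean_le (mean_op_iter k n _)) => // u.
rewrite -[leLHS](mean_cst (mean_op_iter b n x)).
exact: (mean_le (mean_op_iter b n x)).
Qed.

Lemma iter_increasing_r n x (f : S -> \bar R) : increasing f ->
  iter n B f x <= iter n K f x.
Proof.
move=> fI; have [f0 _] := fI; rewrite [leRHS]iter_immigration//.
rewrite -[leLHS](mean_cst (mean_op_iter k n 0%R)).
apply: (mean_le (mean_op_iter k n 0%R)) => u; first exact: iter_kernel_ge0.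
by apply: (mean_le (mean_op_iter b n x)) => // v; exact: increasing_r.
Qed.

Lemma iter_increasing_unit n (x : S) i (f : S -> \bar R) : increasing f -> (0 < x i)%N ->
  iter n B f (unit_state i) <= iter n B f x.
Proof.
move=> fI xi; have [f0 _] := fI.
pose y : S := [ffun j => (x j - (j == i))%N].
have -> : x = (y + unit_state i)%R.
  apply/ffunP => j; rewrite state_addE !ffunE subnK//.
  by case: eqP => [->|].
rewrite (iter_branching BD)//.
rewrite -[leLHS](mean_cst (mean_op_iter b n y)).
apply: (mean_le (mean_op_iter b n y)) => u; first exact: iter_kernel_ge0.
by apply: (mean_le (mean_op_iter b n _)) => // v; exact: increasing_r.
Qed.

Definition present (i : 'I_p) : set S := [set x | (0 < x i)%N].

Lemma increasing_present i : increasing (fun x => (\1_(present i) x)%:E).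
Proof.
split=> [x|x y]; first by rewrite lee_fin.
rewrite lee_fin !indicE; case: (boolP (x \in _)) => [|_]; last by case: (_ \in _).
rewrite inE => /= xi; rewrite mem_set//= /present/= state_addE.
by rewrite addn_gt0 xi.
Qed.

Lemma increasing_moment (alpha : R) : (0 < alpha)%R -> increasing (@moment R p alpha).
Proof.
move=> a0; split=> [x|x y]; first exact: moment_ge0.
by rewrite lee_fin powR_le ?norm1_ge0// norm1D lerDl norm1_ge0.
Qed.

Variable pi : probability S R.
Hypothesis pi_st : forall f : S -> \bar R, (forall x, 0 <= f x) ->
  \int[pi]_x f x = \int[pi]_x K f x.

Lemma stationary_iter n (f : S -> \bar R) : (forall x, 0 <= f x) ->
  \int[pi]_x f x = \int[pi]_x iter n K f x.
Proof.
move=> f0; elim: n => [//|n IH]; rewrite IH pi_st// => x.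
exact: iter_kernel_ge0.
Qed.

(** A stationary start lies above 0, and larger starts give larger expectations; the bound holds at
    every time n. *)
Lemma iter_le_stationary n (f : S -> \bar R) : increasing f ->
  iter n K f 0%R <= \int[pi]_x f x.
Proof.
move=> fI; have [f0 _] := fI.
rewrite (stationary_iter n)// -[leLHS](mean_cst (mean_op_integral pi)).
apply: (mean_le (mean_op_integral pi)) => x; first exact: iter_kernel_ge0.
exact: iter_increasing_l.
Qed.

Lemma immigration_le_stationary (f : S -> \bar R) : increasing f ->
  \int[h]_x f x <= \int[pi]_x f x.
Proof.
move=> fI; have [f0 _] := fI.
by rewrite -kernel_immigration0//; exact: (iter_le_stationary 1).
Qed.

Lemma integral_indicator (mu : probability S R) (A : set S) :
  \int[mu]_x (\1_A x)%:E = mu A.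
Proof. by rewrite integral_indic// setIT. Qed.

Lemma stationary_present n i (f : S -> \bar R) : increasing f ->
  iter n B f (unit_state i) * pi (present i) <= \int[pi]_x f x.
Proof.
move=> fI; have [f0 _] := fI.
rewrite (stationary_iter n)// -integral_cst//.
apply: (@le_trans _ _ (\int[pi]_(x in present i) iter n K f x)).
  apply: ge0_le_integral => //.
  - by move=> x _ /=; exact: iter_kernel_ge0.
  move=> x /= xi; apply: (le_trans (iter_increasing_unit _ _ xi)) => //.
  exact: iter_increasing_r.
by apply: ge0_subset_integral => // x _; exact: iter_kernel_ge0.
Qed.

Variable M : 'M[R]_p.
Hypothesis BM : forall i j, B (coordinate R j) (unit_state i) = (M i j)%:E.

Lemma stationary_absent i j n : pi (present i) = 0 -> (0 < (M ^+ n)%R j i)%R ->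
  h (present j) = 0.
Proof.
move=> pi0 Mji.
pose q := iter n B (fun x => (\1_(present i) x)%:E) (unit_state j).
have q0 : 0 < q.
  rewrite lt_neqAle iter_kernel_ge0 ?andbT; last by move=> x; rewrite lee_fin.
  (* If type i were almost surely absent among the descendants of j, its mean number there would
     vanish, against the positive matrix entry. *)
  apply/eqP => q0; suff : iter n B (coordinate R i) (unit_state j) <= 0.
    by rewrite (iter_coordinate B0 BD BM) sum_unit_state lee_fin leNgt Mji.
  rewrite -[leRHS](mean_cst (mean_op_iter b n (unit_state j))).
  apply: (mean_le_ae (mean_op_iter b n (unit_state j)) (A := present i)) => //;
    first exact: coordinate_ge0.
  by move=> x /negP; rewrite -leqNgt leqn0 => /eqP xi; rewrite /coordinate xi.
have pij : pi (present j) = 0.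
  have := stationary_present n j (increasing_present i).
  rewrite integral_indicator pi0 -/q => qpi.
  apply/eqP; rewrite eq_le measure_ge0 andbT leNgt; apply/negP => pj0.
  by have := lt_le_trans (mule_gt0 q0 pj0) qpi; rewrite ltxx.
have := immigration_le_stationary (increasing_present j).
rewrite !integral_indicator pij => h0.
by apply/eqP; rewrite eq_le h0 measure_ge0.
Qed.

Hypothesis Mcvg : forall i j, (M ^+ n)%R i j @[n --> \oo] --> (0 : R)%R.

Let survival n x := iter n B (fun y => (\1_(~` [set 0%R]) y)%:E) x.

(** The pointwise first-moment bound need not be [pi]-integrable, since [pi] may have infinite mean;
    domination by 1 replaces it. *)
Lemma survival_cvg : \int[pi]_x survival n x @[n --> \oo] --> (0 : \bar R).
Proof.
have s0 n x : 0 <= survival n x by apply: iter_kernel_ge0 => y; rewrite lee_fin.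
have s1 n x : survival n x <= 1.
  rewrite -[leRHS](mean_cst (mean_op_iter b n x)).
  by apply: (mean_le (mean_op_iter b n x)) => y; rewrite lee_fin// indicE;
    case: (_ \in _).
rewrite -[X in _ --> X](integral0 pi setT).
apply: (@dominated_cvg _ _ _ _ _ measurableT _ _ (cst 1)) => //.
- move=> x _; apply: (@squeeze_cvge _ _ _ _ (cst 0) _
    (fun n => (\sum_(i < p) (x i)%:R * \sum_(j < p) (M ^+ n) i j)%R%:E)).
  + by near=> n; rewrite s0/=; exact: (survival_le B0 BD BM).
  + exact: cvg_cst.
  + apply: cvg_EFin; first by near=> n.
    exact: iter_norm1_cvg.
- by apply/integrableP; split => //;
  rewrite integral_cst//= normr1 mul1e probability_setT ltry.
- by move=> n x _; rewrite gee0_abs.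
Unshelve. all: by end_near. Qed.

(** A bound at arbitrarily late times is enough, which suits moments controlled only at multiples of
    a period. *)
Lemma stationary_le_bounded (f : S -> \bar R) (c A : R) : (0 <= c)%R ->
  (forall x, 0 <= f x <= c%:E) ->
  (forall m, exists2 n, (m <= n)%N & iter n K f 0%R <= A%:E) ->
  \int[pi]_x f x <= A%:E.
Proof.
move=> c0 fc HA; have f0 x : 0 <= f x by case/andP: (fc x).
have s0 n x : 0 <= survival n x by apply: iter_kernel_ge0 => y; rewrite lee_fin.
have i0 (x : S) : 0 <= (\1_(~` [set 0%R]) x)%:E :> \bar R by rewrite lee_fin.
(* f (u + v) exceeds f u only where v <> 0. *)
have H n x : iter n K f x <= iter n K f 0%R + c%:E * survival n x.
  rewrite iter_immigration// -[X in _ <= _ + X](mean_cst (mean_op_iter k n 0%R)).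
  rewrite -(meanD (mean_op_iter k n 0%R))//; last by move=> _; rewrite mule_ge0.
  apply: (mean_le (mean_op_iter k n 0%R)) => u; first exact: iter_kernel_ge0.
  rewrite -(meanZ (mean_op_iter b n x))// -[X in _ <= X + _](mean_cst (mean_op_iter b n x)).
  rewrite -(meanD (mean_op_iter b n x))//; last by move=> v; rewrite mule_ge0.
  apply: (mean_le (mean_op_iter b n x)) => // v.
  rewrite indicE; have [->|v0] := eqVneq v 0%R.
    by rewrite addr0 leeDl// mule_ge0// lee_fin.
  rewrite mem_set//=; last exact/eqP.
  rewrite mule1; apply: (@le_trans _ _ c%:E); first by case/andP: (fc (u + v)%R).
  by rewrite leeDr.
apply/lee_addgt0Pr => e e0.
(* Dividing by c + 1 rather than c includes the case c = 0. *)
have c1 : (0 < c + 1)%R by rewrite ltr_wpDl.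
have : \forall n \near \oo, \int[pi]_x survival n x < (e / (c + 1))%:E.
  have /fine_cvgP[sfin scvg] := survival_cvg.
  have slt := cvgr_lt _ scvg _ (divr_gt0 e0 c1).
  near=> n; rewrite -[ltLHS]fineK ?lte_fin; first by near: n; exact: slt.
  by near: n; exact: sfin.
move=> [m _ Hm]; have [n mn HnA] := HA m.
rewrite (stationary_iter n)//.
apply: (@le_trans _ _ (\int[pi]_x (iter n K f 0%R + c%:E * survival n x))).
  by apply: (mean_le (mean_op_integral pi)) => // x; exact: iter_kernel_ge0.
have -> : \int[pi]_x (iter n K f 0%R + c%:E * survival n x) =
    iter n K f 0%R + c%:E * \int[pi]_x survival n x.
  have mpi := mean_op_integral pi.
  rewrite [LHS](meanD mpi); last 2 first.
  - by move=> _; exact: iter_kernel_ge0.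
  - by move=> x; rewrite mule_ge0.
  by congr (_ + _); [exact: (mean_cst mpi)|exact: (meanZ mpi)].
apply: leeD => //; apply: (@le_trans _ _ (c%:E * (e / (c + 1))%:E)).
  by rewrite lee_wpmul2l ?lee_fin// ltW// Hm.
rewrite -EFinM lee_fin mulrA ler_pdivrMr// mulrDr mulr1 mulrC lerDl ltW//.
Unshelve. all: by end_near. Qed.

End immigration.

(** * Ergodicity of the kernel with immigration *)

Section ergodicity.
Variables (R : realType) (p : nat) (alpha : R).
Hypothesis alpha_gt0 : 0 < alpha.
Local Notation S := (state p).
Local Open Scope ereal_scope.
Local Notation w := (@moment R p alpha).
Variables (b k : S -> probability S R) (h : probability S R).
Local Notation B := (kernel_op b).
Local Notation K := (kernel_op k).
Hypothesis B0 : forall f : S -> \bar R, (forall x, 0 <= f x) -> B f 0%R = f 0%R.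
Hypothesis BD : forall x y (f : S -> \bar R), (forall z, 0 <= f z) ->
  B f (x + y)%R = B (fun u => B (fun v => f (u + v)%R) y) x.
Hypothesis KE : forall x (f : S -> \bar R), (forall z, 0 <= f z) ->
  K f x = B (fun u => \int[h]_v f (u + v)%R) x.
Variable M : 'M[R]_p.
Hypothesis BM : forall i j, B (coordinate R j) (unit_state i) = (M i j)%:E.
Hypothesis Mcvg : forall i j, (M ^+ n)%R i j @[n --> \oo] --> (0 : R)%R.
Variable pi : probability S R.
Hypothesis pi_st : forall f : S -> \bar R, (forall x, 0 <= f x) ->
  \int[pi]_x f x = \int[pi]_x K f x.
Variable D : set 'I_p.
Hypothesis MD : forall i j, ~ D i -> D j -> M i j = 0%R.
Local Notation dead := (fun x : S => (\1_(~` avoids D) x)%:E : \bar R).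
Hypothesis hD : \int[h]_x dead x = 0.
Hypothesis Bw : forall i, ~ D i -> B w (unit_state i) < +oo.
Hypothesis hw : \int[h]_x w x < +oo.

Let w0 := @moment_ge0 R p alpha.
Let mK n x := mean_op_iter k n x.
Let mB n x := mean_op_iter b n x.

Let dead_ge0 x : 0 <= dead x. Proof. by rewrite lee_fin. Qed.

Lemma dead_le1 x : dead x <= 1.
Proof. by cbv beta; rewrite lee_fin indicE; case: (_ \in _). Qed.

Lemma dead_alive x : avoids D x -> dead x = 0.
Proof. by move=> Zx; cbv beta; rewrite indicE memNset. Qed.

Lemma dead_dead x : ~ avoids D x -> dead x = 1.
Proof. by move=> Zx; cbv beta; rewrite indicE mem_set. Qed.

Lemma avoids0 : avoids D 0%R.
Proof. by move=> i _; rewrite state_zeroE. Qed.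

Lemma dead_add (x y : S) : dead (x + y)%R <= dead x + dead y.
Proof.
have [Zx|Zx] := pselect (avoids D x); last first.
  apply: (@le_trans _ _ 1); first exact: dead_le1.
  by rewrite (dead_dead Zx) leeDl.
have [Zy|Zy] := pselect (avoids D y); last first.
  apply: (@le_trans _ _ 1); first exact: dead_le1.
  by rewrite (dead_dead Zy) leeDr.
rewrite dead_alive; first exact: adde_ge0.
by apply/avoidsD.
Qed.

Lemma kernel_immigration_dead x : avoids D x -> K dead x = 0.
Proof.
move=> Zx; apply/eqP; rewrite eq_le integral_ge0 ?andbT//.
rewrite KE// -[leRHS](kernel_dead B0 BD BM MD Zx).
apply: (mean_le (mean_op_integral (b x))) => u; first exact: integral_ge0.
have mh := mean_op_integral h.
rewrite -[leRHS]adde0 -hD -[X in _ <= X + _](mean_cst mh).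
by rewrite -(meanD mh)//; apply: (mean_le mh) => // v; exact: dead_add.
Qed.

(** Started at 0 the chain never meets [D], and the integral of a bounded function against [pi] is
    controlled by its expectations from 0. *)
Lemma stationary_dead : \int[pi]_x dead x = 0.
Proof.
apply/eqP; rewrite eq_le integral_ge0 ?andbT//.
apply: (stationary_le_bounded B0 BD KE pi_st BM Mcvg (c := 1)) => // [x|m].
  by rewrite dead_ge0 dead_le1.
by exists m => //; rewrite (iter_dead kernel_immigration_dead)//; exact: avoids0.
Qed.

Lemma iter_immigration_moment_le n x :
  iter n K w x <= (2 `^ alpha)%:E * (iter n K w 0%R + iter n B w x).
Proof.
rewrite (iter_immigration BD KE)//.
have -> : iter n K w 0%R + iter n B w x = iter n K (fun u => w u + iter n B w x) 0%R.
  rewrite (meanD (mK n _))//; last by move=> _; exact: iter_kernel_ge0.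
  by rewrite (mean_cst (mK n _)).
rewrite -(meanZ (mK n _)) ?powR_ge0//; last first.
  by move=> u; rewrite adde_ge0//; exact: iter_kernel_ge0.
apply: (mean_le (mK n _)) => u; first exact: iter_kernel_ge0.
rewrite -[X in X + _](mean_cst (mB n x)) -(meanD (mB n x))//.
rewrite -(meanZ (mB n x)) ?powR_ge0//; last by move=> v; exact: adde_ge0.
by apply: (mean_le (mB n x)) => // v; exact: momentD_le.
Qed.

(** Adding 1 to [w] turns the additive contribution of the immigrants into multiplicative growth.
    The bound may explode with n; only finiteness is wanted. *)
Lemma iter_immigration_moment_fin n : iter n K w 0%R < +oo.
Proof.
have [c1 c1_ge1 Hc1] := kernel_moment_growth alpha_gt0 B0 BD BM MD Bw.
pose q := fine (\int[h]_x w x).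
have qE : \int[h]_x w x = q%:E by rewrite fineK// ge0_fin_numE// integral_ge0.
have q0 : (0 <= q)%R by rewrite fine_ge0// integral_ge0.
have c10 : (0 <= c1)%R by rewrite (le_trans _ c1_ge1).
pose L : R := (2 `^ alpha * (c1 + q) + 1)%R.
have L0 : (0 <= L)%R by rewrite addr_ge0// mulr_ge0 ?powR_ge0// addr_ge0.
have w1 x : 0 <= w x + 1 by rewrite adde_ge0.
have H x : avoids D x -> K (fun y => w y + 1) x <= L%:E * (w x + 1).
  move=> Zx; rewrite [leLHS](meanD (mK 1 x))// (mean_cst (mK 1 x)).
  apply: (@le_trans _ _ ((2 `^ alpha)%:E * (q%:E + c1%:E * w x) + 1)).
    rewrite leeD2r//; apply: (le_trans (iter_immigration_moment_le 1 x)).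
    rewrite lee_wpmul2l ?lee_fin ?powR_ge0//; apply: leeD.
      by rewrite /= (kernel_immigration0 B0 KE)// qE.
    by have := Hc1 1%N x Zx; rewrite expr1.
  rewrite /moment -?EFinM -?EFinD -?EFinM -?EFinD lee_fin /L.
  have : (0 <= norm1 R x `^ alpha)%R by exact: powR_ge0.
  set a := (norm1 R x `^ alpha)%R; set t := (2 `^ alpha)%R => a0.
  have t0 : (0 <= t)%R by exact: powR_ge0.
  have := mulr_ge0 t0 c10; have := mulr_ge0 (mulr_ge0 t0 q0) a0.
  nra.
have HL m x : avoids D x -> iter m K (fun y => w y + 1) x <= (L ^+ m)%:E * (w x + 1).
  elim: m x => [|m IH] x Zx; first by rewrite expr0 mul1e.
  rewrite /=; apply: (@le_trans _ _ (K (fun y => (L ^+ m)%:E * (w y + 1)) x)).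
    apply: (@iter_le_avoids _ _ _ _ kernel_immigration_dead 1) => // y.
      exact: iter_kernel_ge0.
    by rewrite mule_ge0// lee_fin exprn_ge0.
  rewrite [leLHS](meanZ (mK 1 x)) ?exprn_ge0// exprSr EFinM -muleA.
  by rewrite lee_wpmul2l ?lee_fin ?exprn_ge0//; exact: H.
apply: (@le_lt_trans _ _ ((L ^+ n)%:E * (w 0%R + 1))); last first.
  by rewrite moment_0// add0e mule1 ltry.
apply: le_trans (HL n 0%R avoids0).
by apply: (mean_le (mK n _)) => // x; rewrite leeDl.
Qed.

Lemma stationary_moment_fin : \int[pi]_x w x < +oo.
Proof.
have [C [theta [C0 /andP[t0 t1] Hdecay]]] := moment_decay alpha_gt0 B0 BD BM Mcvg MD Bw.
pose c := (2 `^ alpha : R)%R.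
have c0 : (0 < c)%R by rewrite powR_gt0.
(* The factor 2^alpha lost in splitting a moment would spoil the contraction over one step, so N is
   large enough to compensate for it. *)
have [N N0 HN] : exists2 N, (0 < N)%N & (c * (C * theta ^+ N) <= 2^-1)%R.
  have cv : (c * (C * theta ^+ n))%R @[n --> \oo] --> (0 : R)%R.
    rewrite -[X in _ --> X](mulr0 (c * C)%R).
    under eq_cvg do rewrite mulrA.
    apply: cvgM; first exact: cvg_cst.
    by apply: cvg_expr; rewrite ger0_norm ?ltW.
  have h2 : (0 < 2^-1 :> R)%R by rewrite invr_gt0.
  have [n _ Hn] := cvgr_lt _ cv _ h2.
  by exists n.+1 => //; rewrite ltW// Hn/=.
have afin n : iter n K w 0%R = (fine (iter n K w 0%R))%:E.
  by rewrite fineK// ge0_fin_numE ?iter_immigration_moment_fin//; exact: iter_kernel_ge0.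
pose a n := fine (iter n K w 0%R).
have a0 n : (0 <= a n)%R by rewrite fine_ge0//; exact: iter_kernel_ge0.
have step n : (a (n + N)%N <= c * a N + 2^-1 * a n)%R.
  rewrite -lee_fin /a -afin iterD.
  apply: (@le_trans _ _ (iter n K (fun x => (c * a N)%:E + (2^-1)%:E * w x) 0%R)).
    apply: (iter_le_avoids kernel_immigration_dead) => [|x|x|x Zx].
    - exact: avoids0.
    - exact: iter_kernel_ge0.
    - apply: adde_ge0; first by rewrite lee_fin mulr_ge0// ltW.
      by apply: mule_ge0 => //; rewrite lee_fin invr_ge0.
    apply: (le_trans (iter_immigration_moment_le N x)).
    rewrite afin -/(a N) -/c.
    apply: (@le_trans _ _ (c%:E * ((a N)%:E + (C * theta ^+ N)%:E * w x))).
      by rewrite lee_wpmul2l ?lee_fin ?(ltW c0)// leeD2l// Hdecay.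
    rewrite /moment -?EFinM -?EFinD -?EFinM lee_fin mulrDr lerD2l mulrA.
    by rewrite ler_wpM2r ?powR_ge0.
  rewrite (meanD (mK n _)); last 2 first.
  - by move=> _; rewrite lee_fin mulr_ge0// ltW.
  - by move=> x; rewrite mule_ge0// lee_fin invr_ge0.
  by rewrite (mean_cst (mK n _)) (meanZ (mK n _)) ?invr_ge0// afin.
(* The fixed point of the recursion a -> c a_N + a/2; the iteration starts at a_0 = 0. *)
pose A := (2 * (c * a N))%R.
have aA q : (a (q * N)%N <= A)%R.
  elim: q => [|q IH].
    have -> : (a (0 * N)%N = 0)%R by rewrite mul0n /a -[iter _ _ _ _]/(w 0%R) moment_0.
    by rewrite !mulr_ge0// ltW.
  by rewrite mulSn addnC; have := step (q * N)%N; rewrite /A in IH *; lra.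
(* Comparison with the chain from 0 needs bounded functions, so [w] is truncated at n and monotone
   convergence removes the truncation. *)
have bounded (n : nat) : \int[pi]_x mine (w x) n%:R%:E <= A%:E.
  apply: (stationary_le_bounded B0 BD KE pi_st BM Mcvg (c := n%:R)) => // [x|m].
    by rewrite le_min w0 lee_fin ler0n/= ge_min lexx orbT.
  exists (m * N)%N; first by rewrite leq_pmulr.
  apply: (@le_trans _ _ (iter (m * N) K w 0%R)).
    apply: (mean_le (mK _ _)) => x; first by rewrite le_min w0 lee_fin ler0n.
    by rewrite ge_min lexx.
  by rewrite afin lee_fin; exact: aA.
apply: (@le_lt_trans _ _ A%:E); last exact: ltry.
have mono x : {homo (fun n => mine (w x) n%:R%:E) : n m / (n <= m)%N >-> n <= m}.
  move=> n m nm; rewrite le_min ge_min lexx/= ge_min; apply/orP; right.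
  by rewrite lee_fin ler_nat.
have min0 n x : 0 <= mine (w x) n%:R%:E by rewrite le_min w0 lee_fin ler0n.
have : (\int[pi]_x mine (w x) n%:R%:E) @[n --> \oo] -->
    \int[pi]_x limn (fun n => mine (w x) n%:R%:E).
  by apply: cvg_monotone_convergence => // x _; exact: mono.
have -> : \int[pi]_x limn (fun n => mine (w x) n%:R%:E) = \int[pi]_x w x.
  apply: eq_integral => x _; apply/cvg_lim => //.
  apply: cvg_near_cst; exists (Num.truncn (norm1 R x `^ alpha)).+1 => // n /= hn.
  rewrite /mine; case: ltP => //; rewrite lee_fin => hl.
  apply/eqP; rewrite eq_le lee_fin hl/= lee_fin.
  rewrite (le_trans (ltW (truncnS_gt _)))// ler_nat//.
move=> cv; rewrite -(cvg_lim _ cv)//; apply: lime_le; first by apply/cvg_ex; eexists;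
  exact: cv.
by apply: nearW => n; exact: bounded.
Qed.

Lemma iter_immigration_moment_avoids_fin n x : avoids D x -> iter n K w x < +oo.
Proof.
have [C [theta [C0 t01 Hdecay]]] := moment_decay alpha_gt0 B0 BD BM Mcvg MD Bw.
move=> Zx; apply: (le_lt_trans (iter_immigration_moment_le n x)).
rewrite lte_mul_pinfty ?lee_fin ?powR_ge0// lte_add_pinfty ?iter_immigration_moment_fin//.
by apply: (le_lt_trans (Hdecay n x Zx)); rewrite /moment -EFinM ltry.
Qed.

(** For f = f1 - f2 this bounds f(u + v) - f(u). If v = 0 the difference vanishes; otherwise w v >=
    1 absorbs all terms that do not contain v. *)
Lemma growth_increment_le (f1 f2 : S -> \bar R) (u v : S) :
  (forall x, 0 <= f1 x <= w x + 1) -> (forall x, 0 <= f2 x <= w x + 1) ->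
  f1 (u + v)%R + f2 u <=
  f2 (u + v)%R + f1 u + (((2 `^ alpha + 1) * norm1 R u `^ alpha + (2 `^ alpha + 2))%R)%:E * w v.
Proof.
move=> f1w f2w; set t := (2 `^ alpha)%R; have t0 : (0 <= t)%R by exact: powR_ge0.
have u0 : (0 <= norm1 R u `^ alpha)%R by exact: powR_ge0.
have [->|/eqP v0] := eqVneq v 0%R.
  by rewrite moment_0// mule0 adde0 addr0 addeC.
apply: (@le_trans _ _ ((w (u + v)%R + 1) + (w u + 1))).
  by apply: leeD; [case/andP: (f1w (u + v)%R)|case/andP: (f2w u)].
apply: (@le_trans _ _ ((((t + 1) * norm1 R u `^ alpha + (t + 2))%R)%:E * w v));
  last first.
  rewrite leeDr// adde_ge0//; first by case/andP: (f2w (u + v)%R).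
  by case/andP: (f1w u).
have := moment_ge1 alpha_gt0 v0; have := momentD_le alpha_gt0 u v.
rewrite /moment -?EFinD -?EFinM -?EFinD !lee_fin -/t.
set a := (norm1 R u `^ alpha)%R; set c := (norm1 R v `^ alpha)%R => h1 h2.
have : (0 <= a * (c - 1))%R by rewrite mulr_ge0// subr_ge0.
have : (0 <= t * a * (c - 1))%R by rewrite !mulr_ge0// subr_ge0.
have : (0 <= t)%R by [].
nra.
Qed.

(** The chains from x and from 0 share the part u and differ by the progeny v of x. The factor
    depending on u is integrated using the moment of [pi], the factor [w v] decays geometrically. *)
Lemma coupling_bound : exists H theta : R,
  [/\ (0 < H)%R, (0 < theta < 1)%R &
  forall n x (f1 f2 : S -> \bar R), avoids D x ->
    (forall y, 0 <= f1 y <= w y + 1) -> (forall y, 0 <= f2 y <= w y + 1) ->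
    iter n K f1 x + iter n K f2 0%R <=
    iter n K f2 x + iter n K f1 0%R + (H * theta ^+ n)%:E * w x].
Proof.
have [C [theta [C0 t01 Hdecay]]] := moment_decay alpha_gt0 B0 BD BM Mcvg MD Bw.
have pw0 : 0 <= \int[pi]_x w x by apply: integral_ge0.
pose A := fine (\int[pi]_x w x).
have AE : \int[pi]_x w x = A%:E by rewrite fineK// ge0_fin_numE// stationary_moment_fin.
have A0 : (0 <= A)%R by rewrite fine_ge0.
set t := (2 `^ alpha : R)%R; have t0 : (0 <= t)%R by exact: powR_ge0.
pose J := ((t + 1) * A + (t + 2))%R.
have J0 : (0 < J)%R by rewrite ltr_wpDl ?mulr_ge0 ?addr_ge0// ltr_wpDl.
exists (J * C)%R, theta; split => //; first by rewrite mulr_gt0.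
move=> n x f1 f2 Zx f1w f2w.
have f10 y : 0 <= f1 y by case/andP: (f1w y).
have f20 y : 0 <= f2 y by case/andP: (f2w y).
have C1 : (0 <= C * theta ^+ n)%R.
  by case/andP: t01 => th0 _; rewrite mulr_ge0 ?exprn_ge0// ltW.
pose g (u : S) := ((t + 1) * norm1 R u `^ alpha + (t + 2))%R.
have g0 u : (0 <= g u)%R by rewrite addr_ge0 ?mulr_ge0 ?addr_ge0 ?powR_ge0.
have fD (f f' : S -> \bar R) : (forall y, 0 <= f y) -> (forall y, 0 <= f' y) ->
    iter n K f x + iter n K f' 0%R =
    iter n K (fun u => iter n B (fun v => f (u + v)%R + f' u) x) 0%R.
  move=> f0 f'0; rewrite (iter_immigration BD KE)// -(meanD (mK n _))//; last first.
    by move=> u; exact: iter_kernel_ge0.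
  congr (iter n K _ 0%R); apply/funext => u.
  by rewrite (meanD (mB n x))// (mean_cst (mB n x)).
rewrite fD// fD//.
apply: (@le_trans _ _ (iter n K (fun u => iter n B (fun v => f2 (u + v)%R + f1 u) x
    + (g u * (C * theta ^+ n))%:E * w x) 0%R)).
  apply: (mean_le (mK n _)) => u.
    by apply: iter_kernel_ge0 => v; exact: adde_ge0.
  apply: (@le_trans _ _ (iter n B (fun v => f2 (u + v)%R + f1 u) x + (g u)%:E * iter n B w x)).
    rewrite -(meanZ (mB n x))// -(meanD (mB n x)); last 2 first.
    - by move=> v; exact: adde_ge0.
    - by move=> v; rewrite mule_ge0// lee_fin.
    apply: (mean_le (mB n x)) => v; first exact: adde_ge0.
    exact: growth_increment_le.
  by rewrite leeD2l// EFinM -muleA lee_wpmul2l ?lee_fin//; exact: Hdecay.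
rewrite (meanD (mK n _)); last 2 first.
- by move=> u; apply: iter_kernel_ge0 => v; exact: adde_ge0.
- by move=> u; rewrite mule_ge0// lee_fin mulr_ge0.
rewrite leeD2l//.
apply: (@le_trans _ _ (iter n K (fun u => (C * theta ^+ n * norm1 R x `^ alpha)%:E *
    ((t + 1)%:E * w u + (t + 2)%:E)) 0%R)).
  apply: (mean_le (mK n _)) => u; first by rewrite mule_ge0// lee_fin mulr_ge0.
  by rewrite /moment -?EFinM -?EFinD -?EFinM lee_fin /g le_eqVlt; apply/orP; left;
    apply/eqP; ring.
have q0 : (0 <= C * theta ^+ n * norm1 R x `^ alpha)%R by rewrite mulr_ge0 ?powR_ge0.
have r0 u : 0 <= (t + 1)%:E * w u by rewrite mule_ge0// lee_fin addr_ge0.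
have t20 : 0 <= (t + 2)%:E by rewrite lee_fin addr_ge0.
have r1 u : 0 <= (t + 1)%:E * w u + (t + 2)%:E by exact: adde_ge0.
rewrite (meanZ (mK n _))// (meanD (mK n _))//.
rewrite (mean_cst (mK n _)) (meanZ (mK n _)) ?addr_ge0//.
have aA : iter n K w 0%R <= A%:E.
  by rewrite -AE; apply: (iter_le_stationary BD KE pi_st); exact: increasing_moment.
apply: (@le_trans _ _ ((C * theta ^+ n * norm1 R x `^ alpha)%:E *
    ((t + 1)%:E * A%:E + (t + 2)%:E))).
  by rewrite lee_wpmul2l ?lee_fin// leeD2r// lee_wpmul2l// lee_fin addr_ge0.
by rewrite /moment -?EFinM -?EFinD -?EFinM lee_fin /J le_eqVlt; apply/orP; left;
  apply/eqP; ring.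
Qed.

Theorem geometric_ergodicity : exists H theta : R,
  [/\ (0 < H)%R, (0 < theta < 1)%R &
  forall n x (f1 f2 : S -> \bar R), avoids D x ->
    (forall y, 0 <= f1 y <= w y + 1) -> (forall y, 0 <= f2 y <= w y + 1) ->
    iter n K f1 x + \int[pi]_y f2 y <=
    iter n K f2 x + \int[pi]_y f1 y + (H * theta ^+ n)%:E * (w x + 1)].
Proof.
have [H [theta [H0 t01 HH]]] := coupling_bound.
have pw0 : 0 <= \int[pi]_x w x by apply: integral_ge0.
have mpi := mean_op_integral pi.
pose A := fine (\int[pi]_x w x).
have AE : \int[pi]_x w x = A%:E by rewrite fineK// ge0_fin_numE// stationary_moment_fin.
have A0 : (0 <= A)%R by rewrite fine_ge0.
exists (H * (1 + A))%R, theta; split => //; first by rewrite mulr_gt0// ltr_pwDl.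
move=> n x f1 f2 Zx f1w f2w.
have f10 y : 0 <= f1 y by case/andP: (f1w y).
have f20 y : 0 <= f2 y by case/andP: (f2w y).
have e0 : (0 <= H * theta ^+ n)%R.
  by case/andP: t01 => th0 _; rewrite mulr_ge0 ?exprn_ge0// ltW.
have fin_iter (f : S -> \bar R) z : avoids D z -> (forall y, 0 <= f y <= w y + 1) ->
    iter n K f z \is a fin_num.
  move=> Zz fw; have f0 y : 0 <= f y by case/andP: (fw y).
  rewrite ge0_fin_numE; last exact: iter_kernel_ge0.
  apply: (@le_lt_trans _ _ (iter n K (fun y => w y + 1) z)).
    by apply: (mean_le (mK n z)) => // y; case/andP: (fw y).
  rewrite (meanD (mK n z))// (mean_cst (mK n z)) lte_add_pinfty ?ltry//.
  exact: iter_immigration_moment_avoids_fin.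
have fin_pi (f : S -> \bar R) : (forall y, 0 <= f y <= w y + 1) ->
    \int[pi]_y f y \is a fin_num.
  move=> fw; have f0 y : 0 <= f y by case/andP: (fw y).
  rewrite ge0_fin_numE; last exact: integral_ge0.
  apply: (@le_lt_trans _ _ (\int[pi]_y (w y + 1))).
    by apply: (mean_le mpi) => // y; case/andP: (fw y).
  rewrite [ltLHS](meanD mpi)// AE (mean_cst mpi) -EFinD ltry//.
(* [coupling_bound] with f1 and f2 exchanged, integrated over a starting point drawn from [pi],
   compares [pi] with the chain from 0; the moment A of [pi] replaces [w x]. Adding the bound for x
   eliminates the chain from 0. *)
have h2 : \int[pi]_y f2 y + iter n K f1 0%R <=
    \int[pi]_y f1 y + iter n K f2 0%R + (H * theta ^+ n * A)%:E.
  rewrite !(stationary_iter pi_st n (f := f1))// !(stationary_iter pi_st n (f := f2))//.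
  rewrite -(mean_cst mpi (iter n K f1 0%R)) -(mean_cst mpi (iter n K f2 0%R)).
  rewrite EFinM -AE -(meanZ mpi)//.
  have i0 f z : (forall y, 0 <= f y) -> 0 <= iter n K f z by exact: iter_kernel_ge0.
  rewrite -(meanD mpi)//; [|by move=> y; exact: i0..].
  rewrite -(meanD mpi)//; [|by move=> y; exact: i0..].
  rewrite -(meanD mpi)//; last 2 first.
  - by move=> y; rewrite adde_ge0// i0.
  - by move=> y; rewrite mule_ge0// lee_fin.
  apply: (mean_le_ae mpi stationary_dead).
  - by move=> y; rewrite adde_ge0// i0.
  - by move=> y; rewrite adde_ge0 ?adde_ge0 ?i0// mule_ge0// lee_fin.
  by move=> y /contrapT Zy; exact: HH.
have h1 := HH n x f1 f2 Zx f1w f2w.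
move: h1 h2.
rewrite -(fineK (fin_iter f1 x Zx f1w)) -(fineK (fin_iter f2 x Zx f2w)).
rewrite -(fineK (fin_iter f1 _ avoids0 f1w)) -(fineK (fin_iter f2 _ avoids0 f2w)).
rewrite -(fineK (fin_pi f1 f1w)) -(fineK (fin_pi f2 f2w)) /moment.
rewrite -?EFinM -?EFinD -?EFinM -?EFinD !lee_fin.
set a := (norm1 R x `^ alpha)%R; have a0 : (0 <= a)%R by exact: powR_ge0.
set e := (H * theta ^+ n)%R in e0 *.
rewrite (_ : H * (1 + A) * theta ^+ n = e * (1 + A))%R; last by rewrite /e; ring.
have := mulr_ge0 (mulr_ge0 e0 A0) a0.
lra.
Qed.

End ergodicity.

(** * Sums of independent families *)

(** The independence hypothesis speaks of functions on indices, so a list of observed values has to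
    be read as such a function. *)
Lemma uniq_map_surj (I : eqType) (C : Type) (c0 : C) (s : seq I) (v : seq C) :
  uniq s -> size v = size s -> exists c : I -> C, v = map c s.
Proof.
move=> us sv; exists (fun i => nth c0 v (index i s)).
apply: (@eq_from_nth _ c0); first by rewrite size_map.
move=> k kv; have [i0 [s' sE]] : exists i0 s', s = i0 :: s'.
  by case: s us sv => [_ v0|i s' _ _]; [rewrite v0 in kv|exists i, s'].
rewrite (nth_map i0) -?sv// index_uniq// -sv//.
Qed.

Section independent_family.
Variables (R : realType) (p : nat).
Variables (d : measure_display) (Omega : measurableType d).
Variable P : probability Omega R.
Local Notation S := (state p).
Variables (I : choiceType) (V : set I) (Y : I -> {RV P >-> state p}).
Hypothesis Y_indep : mutually_independent V Y.
Local Open Scope ereal_scope.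

(** Lists of states form a countable type, so joint laws of finite subfamilies are determined by
    point masses. *)
Definition values (s : seq I) (w : Omega) : seq S := [seq Y i w | i <- s].

Lemma measurable_RV_preimage i (A : set S) : measurable (Y i @^-1` A).
Proof. by rewrite -[X in measurable X]setTI; exact: measurable_funP. Qed.

Lemma measurable_values s v : measurable (values s @^-1` [set v]).
Proof.
elim: s v => [|i s IH] v.
  have [->|v0] := eqVneq v [::].
    by rewrite (_ : _ @^-1` _ = setT)//; apply/seteqP; split.
  rewrite (_ : _ @^-1` _ = set0)//; apply/seteqP; split => // w /= /esym v0'.
  by rewrite v0' eqxx in v0.
case: v => [|a v].
  by rewrite (_ : _ @^-1` _ = set0)//; apply/seteqP; split.
rewrite (_ : _ @^-1` _ = Y i @^-1` [set a] `&` values s @^-1` [set v]).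
  by apply: measurableI => //; exact: measurable_RV_preimage.
by apply/seteqP; split => w /=; [move=> [-> <-]|move=> [-> <-]].
Qed.

Lemma values_size_neq s v : size v != size s -> values s @^-1` [set v] = set0.
Proof.
move=> sv; apply/seteqP; split => // w /= vE; move: sv.
by rewrite -vE size_map eqxx.
Qed.

Lemma prob_values s (c : I -> S) : uniq s -> [set` s] `<=` V ->
  P (values s @^-1` [set map c s]) = \prod_(i <- s) P (Y i @^-1` [set c i]).
Proof.
move=> us sV; pose J : {fset I} := [fset i in s]%fset.
have Js : perm_eq J s.
  by apply: uniq_perm => // i; rewrite !inE.
rewrite -(perm_big _ Js) -(Y_indep (J := J) (B := fun i => [set c i]))//.
  congr (P _); apply/seteqP; split => w /=.
    by move=> /eq_in_map h i /=; rewrite !inE => /h.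
  move=> h; apply/eq_in_map => i si; apply: h => /=.
  by rewrite !inE.
by move=> i /=; rewrite !inE => si; exact: sV.
Qed.

Lemma values_independent s t v u : uniq (s ++ t) -> [set` s ++ t] `<=` V ->
  P (values s @^-1` [set v] `&` values t @^-1` [set u]) =
  P (values s @^-1` [set v]) * P (values t @^-1` [set u]).
Proof.
move=> ust stV; have [sv|sv] := eqVneq (size v) (size s); last first.
  by rewrite values_size_neq// set0I measure0 mul0e.
have [tu|tu] := eqVneq (size u) (size t); last first.
  by rewrite (values_size_neq tu) setI0 measure0 mule0.
have := ust; rewrite cat_uniq => /and3P[us /hasPn st ut].
have [c1 v1] := uniq_map_surj 0%R us sv; have [c2 u2] := uniq_map_surj 0%R ut tu.
have sV : [set` s] `<=` V by move=> i /= si; apply: stV; rewrite /= mem_cat si.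
have tV : [set` t] `<=` V by move=> i /= ti; apply: stV; rewrite /= mem_cat ti orbT.
pose c i := if i \in s then c1 i else c2 i.
have c1E : {in s, c =1 c1} by move=> i si; rewrite /c si.
have c2E : {in t, c =1 c2} by move=> i ti; rewrite /c (negbTE (st i ti)).
rewrite (_ : _ `&` _ = values (s ++ t) @^-1` [set map c (s ++ t)]).
  rewrite prob_values// v1 u2 !prob_values// big_cat/=; congr (_ * _).
    by rewrite [LHS]big_seq [RHS]big_seq; apply: eq_bigr => i si; rewrite c1E.
  by rewrite [LHS]big_seq [RHS]big_seq; apply: eq_bigr => i ti; rewrite c2E.
have e1 : map c s = v by rewrite v1; exact/eq_in_map.
have e2 : map c t = u by rewrite u2; exact/eq_in_map.
rewrite map_cat e1 e2.
apply/seteqP; split => w /=; rewrite /values map_cat.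
  by move=> [-> ->].
move=> /eqP; rewrite eqseq_cat ?size_map ?sv// => /andP[/eqP ? /eqP ?].
by split.
Qed.

Lemma values_same_law s (sigma : I -> I) v : uniq s -> uniq (map sigma s) ->
  [set` s] `<=` V -> [set` map sigma s] `<=` V ->
  (forall i c, i \in s -> P (Y (sigma i) @^-1` [set c]) = P (Y i @^-1` [set c])) ->
  P (values (map sigma s) @^-1` [set v]) = P (values s @^-1` [set v]).
Proof.
move=> us uss sV ssV same; have [sv|sv] := eqVneq (size v) (size s); last first.
  by rewrite !values_size_neq// size_map.
have [|c vE] := uniq_map_surj 0%R uss (v := v); first by rewrite size_map.
rewrite {1}vE prob_values// vE -map_comp prob_values// big_map.
by rewrite big_seq [RHS]big_seq; apply: eq_bigr => i si; rewrite same.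
Qed.

Definition family_sum (s : seq I) (w : Omega) : S := (\sum_(i <- s) Y i w)%R.

Lemma family_sumE s w : family_sum s w = (\sum_(z <- values s w) z)%R.
Proof. by rewrite /family_sum /values big_map. Qed.

Lemma family_sum_cat s t w : family_sum (s ++ t) w = (family_sum s w + family_sum t w)%R.
Proof. by rewrite /family_sum big_cat. Qed.

Lemma measurable_values_comp (T : Type) (H : seq S -> T) s A :
  measurable ((H \o values s) @^-1` A).
Proof.
pose F v := if v \in H @^-1` A then values s @^-1` [set v] else set0.
rewrite (_ : _ @^-1` _ = \bigcup_v F v).
  apply: countable_bigcupT_measurable; first exact: countableP.
  by move=> v; rewrite /F; case: ifP => // _; exact: measurable_values.
apply/seteqP; split => w /=.
  by move=> Aw; exists (values s w) => //; rewrite /F mem_set.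
by move=> [v _]; rewrite /F; case: ifP => // /set_mem /= Av ->.
Qed.

Lemma measurable_family_sum s A : measurable (family_sum s @^-1` A).
Proof.
rewrite (_ : family_sum s = (fun v => \sum_(z <- v) z)%R \o values s).
  exact: measurable_values_comp.
by apply/funext => w; rewrite family_sumE.
Qed.

Lemma ge0_integral_indep (C : countType) (g : Omega -> C) (E : set Omega)
    (H : C -> \bar R) :
  measurable E -> (forall c, measurable (g @^-1` [set c])) ->
  (forall c, 0 <= H c) ->
  (forall c, P (E `&` g @^-1` [set c]) = P E * P (g @^-1` [set c])) ->
  \int[P]_(w in E) H (g w) = P E * \int[P]_w H (g w).
Proof.
move=> mE mg H0 ind.
have mHg (D : set Omega) : measurable_fun D (H \o g) by exact: measurable_fun_fibers.
rewrite (@ge0_integral_comp_fibers _ _ _ P _ g E H)//.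
rewrite (@ge0_integral_comp_fibers _ _ _ P _ g setT H)//.
have -> : P E = (fine (P E))%:E by rewrite fineK// fin_num_measure.
rewrite -esumZl ?lee_fin ?fine_ge0//; last by move=> c; rewrite mule_ge0.
apply: eq_esum => c _; rewrite setTI fineK ?fin_num_measure//.
by rewrite muleCA; congr (_ * _); exact: ind.
Qed.

(** Independence of the two blocks allows the second to be evaluated at a separate point w' of the
    same probability space. *)
Lemma integral_family_sum_cat s t (f : S -> \bar R) : uniq (s ++ t) ->
  [set` s ++ t] `<=` V -> (forall x, 0 <= f x) ->
  \int[P]_w f (family_sum (s ++ t) w) =
  \int[P]_w \int[P]_w' f (family_sum s w + family_sum t w')%R.
Proof.
move=> ust stV f0.
pose G a := \int[P]_w' f (a + family_sum t w')%R.
have G0 a : 0 <= G a by apply: integral_ge0.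
have mv u c : measurable (values u @^-1` [set c]) by exact: measurable_values.
rewrite (@ge0_integral_fibers _ _ _ P _ (values s))//; last first.
  rewrite (_ : (fun w => _) = (fun v => f (\sum_(z <- v) z)%R) \o values (s ++ t)).
    exact: measurable_fun_fibers.
  by apply/funext => w; rewrite /= family_sumE.
transitivity (\int[P]_w G (\sum_(z <- values s w) z)%R); last first.
  by apply: eq_integral => w _; rewrite family_sumE.
rewrite (@ge0_integral_comp_fibers _ _ _ P _ (values s) setT
  (fun v => G (\sum_(z <- v) z)%R))//; last first.
  exact: (@measurable_fun_fibers _ _ _ (values s) _ _ (fun v => G (\sum_(z <- v) z)%R)).
apply: eq_esum => v _; rewrite setTI.
transitivity (\int[P]_(w in values s @^-1` [set v])
    f (\sum_(z <- v) z + \sum_(z <- values t w) z)%R).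
  by apply: eq_integral => w /set_mem /= wv; rewrite family_sum_cat !family_sumE wv.
rewrite (@ge0_integral_indep _ (values t) _ (fun u => f (\sum_(z <- v) z + \sum_(z <- u) z)%R))//.
  rewrite muleC; congr (_ * _); apply: eq_integral => w _.
  by rewrite family_sumE.
by move=> u; exact: values_independent.
Qed.

Lemma integral_family_sum_same_law s (sigma : I -> I) (f : S -> \bar R) :
  uniq s -> uniq (map sigma s) ->
  [set` s] `<=` V -> [set` map sigma s] `<=` V ->
  (forall i c, i \in s -> P (Y (sigma i) @^-1` [set c]) = P (Y i @^-1` [set c])) ->
  (forall x, 0 <= f x) ->
  \int[P]_w f (family_sum (map sigma s) w) = \int[P]_w f (family_sum s w).
Proof.
move=> us uss sV ssV same f0.
have E u : \int[P]_w f (family_sum u w) = \esum_(v in setT)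
    f (\sum_(z <- v) z)%R * P (values u @^-1` [set v]).
  transitivity (\int[P]_w f (\sum_(z <- values u w) z)%R).
    by apply: eq_integral => w _; rewrite family_sumE.
  rewrite (@ge0_integral_comp_fibers _ _ _ P _ (values u) setT (fun v => f (\sum_(z <- v) z)%R))//.
  - by apply: eq_esum => v _; rewrite setTI.
  - by move=> c; exact: measurable_values.
  - apply: (@measurable_fun_fibers _ _ _ (values u) _ _ (fun v => f (\sum_(z <- v) z)%R)).
    by move=> c; exact: measurable_values.
by rewrite !E; apply: eq_esum => v _; rewrite values_same_law.
Qed.

End independent_family.

(** * Kernels of the Galton-Watson process *)

Section galton_watson.
Variables (R : realType) (p : nat).
Variables (d : measure_display) (Omega : measurableType d).
Variable P : probability Omega R.
Variables (xi : 'I_p -> nat -> nat -> {RV P >-> state p}).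
Variable eta : nat -> {RV P >-> state p}.
Variable X : nat -> {RV P >-> state p}.
Hypothesis X_GW : GW_process xi eta X.
Local Notation S := (state p).
Local Notation Y := (GW_family xi eta (X 0%N)).
Local Notation V := (@GW_index_valid p).
Local Notation Yindep := (GW_independent X_GW : mutually_independent V Y).
Local Open Scope ereal_scope.

Definition parents n (x : S) : seq (GW_index p) :=
  [seq inl (inr (i, n, j)) | i <- enum 'I_p, j <- index_iota 1 (x i).+1].

Definition immigrant n : GW_index p := inr n.

Lemma mem_parents n (x : S) u : u \in parents n x ->
  exists i j, [/\ u = inl (inr (i, n, j)), (0 < j)%N & (j <= x i)%N].
Proof.
move=> /allpairsPdep [i [j [_]]]; rewrite mem_index_iota ltnS => /andP[j0 jx] ->.
by exists i, j.
Qed.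

Lemma parents_uniq n (x : S) : uniq (parents n x).
Proof.
apply: allpairs_uniq_dep; first exact: enum_uniq.
  by move=> i _; exact: iota_uniq.
by move=> [i j] [i' j'] _ _ /= [-> ->].
Qed.

Lemma parents_immigrant_uniq n (x : S) : uniq (parents n x ++ [:: immigrant n]).
Proof.
rewrite cat_uniq parents_uniq /= orbF andbT.
by apply/negP => /mem_parents [i [j []]].
Qed.

Definition generation (u : GW_index p) : nat :=
  match u with
  | inl (inl _) => 0
  | inl (inr (_, n, _)) => n
  | inr n => n
  end.

Lemma parents_valid n (x : S) u : (0 < n)%N ->
  u \in parents n x ++ [:: immigrant n] -> V u /\ generation u = n.
Proof.
move=> n0; rewrite mem_cat inE => /orP[/mem_parents [i [j [-> j0 _]]]|/eqP ->] //=.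
by rewrite /GW_index_valid/= n0 j0.
Qed.

Lemma GW_stepE (X0 : {RV P >-> state p}) n x w : GW_step xi eta n x w =
  family_sum (GW_family xi eta X0) (parents n x ++ [:: immigrant n]) w.
Proof.
rewrite /GW_step family_sum_cat; congr (_ + _)%R; last by rewrite /family_sum big_seq1.
by rewrite /family_sum big_allpairs_dep big_enum.
Qed.

(** Relabelling to other variables of the same law: [m] changes the generation, and adding [x i]
    skips the offspring variables already used by the individuals of x. It serves additivity ([m]
    the identity) and time homogeneity (x = 0). *)
Definition shift_parent (m : nat -> nat) (x : S) (u : GW_index p) : GW_index p :=
  match u with
  | inl (inr (i, n, j)) => inl (inr (i, m n, j + x i)%N)
  | inr n => inr (m n)
  | _ => u
  end.

Lemma GW_family_same_law m x u c : V u -> (forall n, (0 < n)%N -> (0 < m n)%N) ->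
  P (Y (shift_parent m x u) @^-1` [set c]) = P (Y u @^-1` [set c]).
Proof.
move=> Vu mn; case: u Vu => [[[]//|[[i n] j]]|n] /=; rewrite /GW_index_valid/=.
  move=> /andP[n0 j0].
  have h1 := GW_offspring_id X_GW i (mn n n0) (ltn_addr (x i) j0) (A := [set c]) I.
  have h2 := GW_offspring_id X_GW i n0 j0 (A := [set c]) I.
  exact: etrans h1 (esym h2).
move=> n0.
have h1 := GW_innovation_id X_GW (mn n n0) (A := [set c]) I.
have h2 := GW_innovation_id X_GW n0 (A := [set c]) I.
exact: etrans h1 (esym h2).
Qed.

(** Laws are used only through their integrals, which is all that the kernels [b], [k] and [h] are
    required to satisfy. *)
Lemma exists_law (g : Omega -> S) : (forall A, measurable (g @^-1` A)) ->
  exists mu : probability S R, forall f : S -> \bar R, (forall x, 0 <= f x) ->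
    \int[mu]_x f x = \int[P]_w f (g w).
Proof.
move=> mg.
have mg' : measurable_fun setT g by move=> _ A _; rewrite setTI.
pose gm := isMeasurableFun.Build _ _ _ _ g mg'.
pose gf : {mfun Omega >-> S} := HB.pack g gm.
by exists (distribution P gf) => f f0; rewrite ge0_integral_distribution.
Qed.

Lemma exists_laws (T : Type) (g : T -> Omega -> S) :
  (forall t A, measurable (g t @^-1` A)) ->
  exists mu : T -> probability S R, forall t (f : S -> \bar R), (forall x, 0 <= f x) ->
    \int[mu t]_x f x = \int[P]_w f (g t w).
Proof.
move=> mg; have h t := cid (exists_law (mg t)).
by exists (fun t => projT1 (h t)) => t; exact: (projT2 (h t)).
Qed.

Lemma measurable_GW_step n x A : measurable (GW_step xi eta n x @^-1` A).
Proof.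
(* Any variable may stand in for the initial state, which does not enter a step from a given x;
   [eta 0] is at hand. *)
rewrite (_ : GW_step xi eta n x =
    family_sum (GW_family xi eta (eta 0%N)) (parents n x ++ [:: immigrant n])).
  exact: measurable_family_sum.
by apply/funext => w; exact: GW_stepE.
Qed.

Lemma measurable_GW_from x n A : measurable (GW_from xi eta x n @^-1` A).
Proof.
elim: n A => [|n IH] A.
  have [Ax|Ax] := pselect (A x).
    by rewrite (_ : _ @^-1` _ = setT)//; apply/seteqP; split.
  by rewrite (_ : _ @^-1` _ = set0)//; apply/seteqP; split.
rewrite (_ : _ @^-1` _ = \bigcup_y (GW_from xi eta x n @^-1` [set y] `&`
    GW_step xi eta n.+1 y @^-1` A)).
  apply: countable_bigcupT_measurable; first exact: countableP.
  by move=> y; apply: measurableI => //; exact: measurable_GW_step.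
apply/seteqP; split => w /=; first by move=> Aw; exists (GW_from xi eta x n w).
by move=> [y _ [/= -> ]].
Qed.

Definition after m (s : seq (GW_index p)) :=
  [/\ uniq s, [set` s] `<=` V & forall u, u \in s -> (m < generation u)%N].

(** The state at time m + 1 is a function of the state at time m and the variables [t] of generation
    m + 1. Partitioning over both leaves events about time m and the enlarged list [t ++ s], to
    which the induction hypothesis applies. *)
Lemma GW_from_independent m x y s v : after m s ->
  P (GW_from xi eta x m @^-1` [set y] `&` values Y s @^-1` [set v]) =
  P (GW_from xi eta x m @^-1` [set y]) * P (values Y s @^-1` [set v]).
Proof.
have mF n z : measurable (GW_from xi eta x n @^-1` [set z]) by exact: measurable_GW_from.
have mv t c : measurable (values Y t @^-1` [set c]) by exact: measurable_values.
elim: m y s v => [|m IH] z s v.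
  move=> _; have [->|xz] := eqVneq x z.
    rewrite (_ : _ @^-1` [set z] = setT); last by apply/seteqP; split.
    by rewrite setTI probability_setT mul1e.
  rewrite (_ : GW_from xi eta x 0 @^-1` [set z] = set0); last first.
    by apply/seteqP; split => // w /= /eqP; rewrite (negbTE xz).
  by rewrite set0I measure0 mul0e.
move=> [us sV sm].
(* Independence from the values on s may be checked on each piece of a countable partition of E. *)
have indep_fibers (C : countType) (g : Omega -> C) (E : set Omega) :
    measurable E -> (forall c, measurable (g @^-1` [set c])) ->
    (forall c, P ((E `&` g @^-1` [set c]) `&` values Y s @^-1` [set v]) =
      P (E `&` g @^-1` [set c]) * P (values Y s @^-1` [set v])) ->
    P (E `&` values Y s @^-1` [set v]) = P E * P (values Y s @^-1` [set v]).
  move=> mE mg h.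
  have mEv : measurable (E `&` values Y s @^-1` [set v]) by exact: measurableI.
  rewrite [LHS](@measure_fibers _ _ _ P _ g _ mEv)//.
  rewrite [X in _ = X * _](@measure_fibers _ _ _ P _ g _ mE)//.
  have -> : P (values Y s @^-1` [set v]) = (fine (P (values Y s @^-1` [set v])))%:E.
    by rewrite fineK// fin_num_measure.
  rewrite muleC -esumZl ?lee_fin ?fine_ge0//.
  apply: eq_esum => c _; rewrite fineK ?fin_num_measure// muleC -h.
  by congr (P _); rewrite setIAC.
apply: (indep_fibers _ (GW_from xi eta x m)) => // y.
set t := parents m.+1 y ++ [:: immigrant m.+1].
apply: (indep_fibers _ (values Y t)) => // [|u]; first exact: measurableI.
have tV := @parents_valid m.+1 y ^~ (ltn0Sn m).
have ats : after m (t ++ s).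
  split; first rewrite cat_uniq parents_immigrant_uniq us andbT/=.
  - apply/hasPn => i si; apply/negP => /tV [_ gi].
    by have := sm i si; rewrite gi ltnn.
  - by move=> i /=; rewrite mem_cat => /orP[/tV []|/sV].
  - by move=> i; rewrite mem_cat => /orP[/tV [_ ->]|/sm /ltnW].
have at1 : after m t.
  split; first exact: parents_immigrant_uniq.
  - by move=> i /tV [].
  - by move=> i /tV [_ ->].
have [zu|zu] := eqVneq (\sum_(a <- u) a)%R z; last first.
  rewrite (_ : _ `&` values Y t @^-1` [set u] = set0).
    by rewrite set0I measure0 mul0e.
  apply/seteqP; split => // w [[/= wz wy] wu].
  by move: zu; rewrite -wz /= wy (GW_stepE (X 0%N)) family_sumE wu eqxx.
have -> : GW_from xi eta x m.+1 @^-1` [set z] `&` GW_from xi eta x m @^-1` [set y] `&`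
    values Y t @^-1` [set u] = GW_from xi eta x m @^-1` [set y] `&` values Y t @^-1` [set u].
  apply/seteqP; split => w [/=]; first by move=> [_ wy] wu.
  by move=> wy wu; split=> //; split=> //;
    rewrite /= wy (GW_stepE (X 0%N)) family_sumE wu.
rewrite -setIA IH// -muleA -(values_independent Yindep); last 2 first.
- by case: ats.
- by case: ats.
have [ut|ut] := eqVneq (size u) (size t); last first.
  by rewrite (values_size_neq Y ut) !set0I setI0 measure0 !mule0.
rewrite (_ : values Y t @^-1` [set u] `&` values Y s @^-1` [set v] =
  values Y (t ++ s) @^-1` [set u ++ v]); first by rewrite IH.
have vcat w : values Y (t ++ s) w = values Y t w ++ values Y s w by exact: map_cat.
apply/seteqP; split => w /=; rewrite vcat; first by move=> [-> ->].
by move=> /eqP; rewrite eqseq_cat ?size_map// => /andP[/eqP ? /eqP ?].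
Qed.

Variables (b k : S -> probability S R) (h : probability S R).
Hypothesis bE : forall x (f : S -> \bar R), (forall z, 0 <= f z) ->
  \int[b x]_y f y = \int[P]_w f (family_sum Y (parents 1%N x) w).
Hypothesis kE : forall x (f : S -> \bar R), (forall z, 0 <= f z) ->
  \int[k x]_y f y = \int[P]_w f (GW_from xi eta x 1%N w).
Hypothesis hE : forall f : S -> \bar R, (forall z, 0 <= f z) ->
  \int[h]_y f y = \int[P]_w f (eta 1%N w).
Local Notation B := (kernel_op b).
Local Notation K := (kernel_op k).

Lemma offspring_kernel0 (f : S -> \bar R) : (forall x, 0 <= f x) -> B f 0%R = f 0%R.
Proof.
move=> f0; rewrite /kernel_op bE//.
transitivity (\int[P]_w cst (f 0%R) w).
  apply: eq_integral => w _; rewrite /family_sum big_allpairs_dep big1// => i _.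
  by rewrite state_zeroE big_nil.
by rewrite integral_cst//= probability_setT mule1.
Qed.

Lemma offspring_kernel_add x y (f : S -> \bar R) : (forall z, 0 <= f z) ->
  B f (x + y)%R = B (fun u => B (fun v => f (u + v)%R) y) x.
Proof.
move=> f0; rewrite {1}/kernel_op bE//.
(* The children of y are renumbered to follow those of x, so that the two blocks use disjoint
   variables. *)
have if0 u : 0 <= B (fun v => f (u + v)%R) y by apply: integral_ge0.
rewrite [RHS]bE//; set t := map (shift_parent id x) (parents 1%N y).
have tE u : u \in t -> exists i j, [/\ u = inl (inr (i, 1%N, j)), (x i < j)%N & (j <= x i + y i)%N].
  move=> /mapP [u' /mem_parents [i [j [-> j0 jy]]] ->] /=.
  exists i, (j + x i)%N; split => //; first by rewrite -{1}(add0n (x i)) ltn_add2r.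
  by rewrite addnC leq_add2l.
have ut : uniq t.
  rewrite map_inj_in_uniq ?parents_uniq// => u u' /mem_parents [i [j [-> _ _]]].
  by move=> /mem_parents [i' [j' [-> _ _]]] /= [-> /addIn ->].
have ust : uniq (parents 1%N x ++ t).
  rewrite cat_uniq parents_uniq ut andbT/=; apply/hasPn => u /tE [i [j [-> xj _]]].
  by apply/negP => /mem_parents [i' [j' [[<- <-] _]]]; rewrite leqNgt xj.
have xV : [set` parents 1%N x] `<=` V.
  by move=> u /= ux; have [] := @parents_valid 1%N x u isT; rewrite // mem_cat ux.
have yV : [set` parents 1%N y] `<=` V.
  by move=> u /= uy; have [] := @parents_valid 1%N y u isT; rewrite // mem_cat uy.
have tV : [set` t] `<=` V.
  by move=> u /= /tE [i [j [-> xj _]]]; rewrite /GW_index_valid/= (leq_ltn_trans _ xj).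
transitivity (\int[P]_w f (family_sum Y (parents 1%N x ++ t) w)).
  apply: eq_integral => w _; congr f;
    rewrite family_sum_cat /family_sum big_map !big_allpairs_dep.
  rewrite -big_split/=; apply: eq_bigr => i _.
  rewrite state_addE (@big_cat_nat _ _ _ (x i).+1)//=; last by rewrite ltnS leq_addr.
  congr (_ + _)%R; rewrite (_ : (x i + y i).+1 = ((y i).+1 + x i)%N); last first.
    by rewrite addSn addnC.
  by rewrite -{1}[(x i).+1]add1n big_addn addnK.
rewrite (integral_family_sum_cat Yindep ust)//; last first.
  by move=> u /=; rewrite mem_cat => /orP[/xV|/tV].
apply: eq_integral => w _.
rewrite [RHS]bE// (integral_family_sum_same_law Yindep (sigma := shift_parent id x)
  (f := fun v => f (family_sum Y (parents 1%N x) w + v)%R))//.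
- exact: parents_uniq.
- by move=> u c uy; apply: GW_family_same_law => //; exact: yV.
Qed.

Lemma step_kernelE x (f : S -> \bar R) : (forall z, 0 <= f z) ->
  K f x = B (fun u => \int[h]_v f (u + v)%R) x.
Proof.
move=> f0; rewrite /kernel_op kE// bE; last by move=> z; exact: integral_ge0.
have xV u : u \in parents 1%N x ++ [:: immigrant 1%N] -> V u.
  by move=> /(parents_valid (ltn0Sn _)) [].
transitivity (\int[P]_w f (family_sum Y (parents 1%N x ++ [:: immigrant 1%N]) w)).
  by apply: eq_integral => w _; rewrite -(GW_stepE (X 0%N)).
rewrite (integral_family_sum_cat Yindep)//; last exact: parents_immigrant_uniq.
apply: eq_integral => w _; rewrite hE//; apply: eq_integral => w' _.
by rewrite [family_sum _ [:: _] _]/family_sum big_seq1.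
Qed.

Lemma offspring_kernel_unit i (f : S -> \bar R) : (forall x, 0 <= f x) ->
  B f (unit_state i) = \int[P]_w f (xi i 1%N 1%N w).
Proof.
move=> f0; rewrite /kernel_op bE//; apply: eq_integral => w _; congr f.
rewrite /family_sum big_allpairs_dep big_enum (bigD1 i)//= ffunE eqxx.
rewrite big_nat1 big1 ?addr0// => j /negbTE ji.
by rewrite ffunE ji big_nil.
Qed.

(** Time homogeneity: generation n + 1 is a relabelling of generation 1. *)
Lemma expectation_GW_step n x (f : S -> \bar R) : (forall z, 0 <= f z) ->
  \int[P]_w f (family_sum Y (parents n.+1 x ++ [:: immigrant n.+1]) w) = K f x.
Proof.
move=> f0; rewrite /kernel_op kE//.
pose s := parents 1%N x ++ [:: immigrant 1%N].
transitivity (\int[P]_w f (family_sum Y s w)); last first.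
  by apply: eq_integral => w _; rewrite -(GW_stepE (X 0%N)).
have E : parents n.+1 x ++ [:: immigrant n.+1] = map (shift_parent (fun=> n.+1) 0%R) s.
  rewrite map_cat/=; congr (_ ++ _); rewrite /parents map_allpairs.
  by apply: eq_allpairs => i j; rewrite /= state_zeroE addn0.
rewrite E (integral_family_sum_same_law Yindep)// -?E.
- exact: parents_immigrant_uniq.
- exact: parents_immigrant_uniq.
- by move=> u /(parents_valid (ltn0Sn _)) [].
- by move=> u /(parents_valid (ltn0Sn _)) [].
- by move=> u c us; apply: GW_family_same_law => //; case: (parents_valid (ltn0Sn _) us).
Qed.

Lemma GW_from_Markov n x (f : S -> \bar R) : (forall z, 0 <= f z) ->
  \int[P]_w f (GW_from xi eta x n.+1 w) = \int[P]_w K f (GW_from xi eta x n w).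
Proof.
move=> f0.
have mF m z : measurable (GW_from xi eta x m @^-1` [set z]) by exact: measurable_GW_from.
have mFf m (g : S -> \bar R) (E : set Omega) : measurable_fun E (g \o GW_from xi eta x m).
  exact: measurable_fun_fibers.
have K0 z : 0 <= K f z by apply: integral_ge0.
rewrite (@ge0_integral_fibers _ _ _ P _ (GW_from xi eta x n))//; last exact: (mFf n.+1 f).
rewrite (@ge0_integral_comp_fibers _ _ _ P _ (GW_from xi eta x n) setT (K f))//.
apply: eq_esum => y _; rewrite setTI.
set t := parents n.+1 y ++ [:: immigrant n.+1].
transitivity (\int[P]_(w in GW_from xi eta x n @^-1` [set y]) f (\sum_(z <- values Y t w) z)%R).
  by apply: eq_integral => w /set_mem /= wy; rewrite wy (GW_stepE (X 0%N)) family_sumE.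
rewrite (@ge0_integral_indep _ _ _ P _ (values Y t) _ (fun v => f (\sum_(z <- v) z)%R))//.
- rewrite muleC -(expectation_GW_step n y f0); congr (_ * _).
  by apply: eq_integral => w _; rewrite family_sumE.
- by move=> c; exact: measurable_values.
- move=> c; apply: GW_from_independent; split; first exact: parents_immigrant_uniq.
  + by move=> i /(parents_valid (ltn0Sn n)) [].
  + by move=> i /(parents_valid (ltn0Sn n)) [_ ->].
Qed.

Lemma expectation_GW_from n x (f : S -> \bar R) : (forall z, 0 <= f z) ->
  \int[P]_w f (GW_from xi eta x n w) = iter n K f x.
Proof.
elim: n f => [|n IH] f f0 /=.
  by rewrite (integral_cst P measurableT (f x))/= probability_setT mule1.
rewrite GW_from_Markov// IH -?iterSr// => z; exact: integral_ge0.
Qed.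

(** Invariance on singletons, weighted by f and summed, gives invariance for functions after
    exchanging the two sums. *)
Lemma stationary_kernel (pi : probability S R) : stationary xi eta pi ->
  forall f : S -> \bar R, (forall x, 0 <= f x) ->
  \int[pi]_x f x = \int[pi]_x K f x.
Proof.
move=> st f f0.
have f0' x : 0 <= (fine (pi [set x]))%:E by rewrite lee_fin fine_ge0.
have k0' x y : 0 <= (fine (k x [set y]))%:E by rewrite lee_fin fine_ge0.
have stE y : (fine (pi [set y]))%:E =
    \esum_(x in setT) (fine (pi [set x]))%:E * (fine (k x [set y]))%:E.
  rewrite fineK ?fin_num_measure// st -integral_state//.
  apply: eq_integral => x _; rewrite fineK ?fin_num_measure//.
  rewrite -integral_indicator kE; last by move=> z; rewrite lee_fin.
  have mA : measurable (GW_from xi eta x 1%N @^-1` [set y]) by exact: measurable_GW_from.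
  transitivity (\int[P]_w (\1_(GW_from xi eta x 1%N @^-1` [set y]) w)%:E).
    by rewrite integral_indic// setIT.
  by apply: eq_integral => w _; rewrite !indicE.
rewrite integral_state//.
transitivity (\esum_(y in setT) \esum_(x in setT)
    (fine (pi [set x]))%:E * ((fine (k x [set y]))%:E * f y)).
  apply: eq_esum => y _; rewrite stE muleC -esumZl//; last by move=> x; rewrite mule_ge0.
  by apply: eq_esum => x _; rewrite muleC muleA.
rewrite esum_exchange; last by move=> x y; rewrite !mule_ge0.
rewrite integral_state; last by move=> x; apply: integral_ge0.
apply: eq_esum => x _; rewrite /kernel_op integral_state// esumZl// => y.
by rewrite mule_ge0.
Qed.

End galton_watson.

(** * The weighted distance *)

(* The weight 2 / (1 + theta) lies strictly between 1 and 1 / theta. *)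
Lemma geometric_weight_series_le (R : realType) (u : nat -> \bar R) (H theta W : R) :
  0 < H -> 0 < theta < 1 -> 0 <= W ->
  (forall n, 0 <= u n <= (H * theta ^+ n * W)%:E)%E ->
  (\sum_(0 <= n <oo) (((2 / (1 + theta)) ^+ n)%:E * u n) <=
   (H / (1 - 2 / (1 + theta) * theta) * W)%:E)%E.
Proof.
move=> H0 /andP[t0 t1] W0 uH; set a := 2 / (1 + theta); set q := a * theta.
have tp : 0 < 1 + theta by rewrite ltr_wpDl.
have a0 : 0 < a by rewrite divr_gt0.
have q0 : 0 <= q by rewrite mulr_ge0 ?(ltW a0)// ltW.
(* q = 2 theta / (1 + theta), which is less than 1 exactly because theta < 1. *)
have q1 : q < 1 by rewrite /q /a mulrAC ltr_pdivrMr// mul1r; lra.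
have q1' : 0 < 1 - q by rewrite subr_gt0.
have u0 n : (0 <= u n)%E by case/andP: (uH n).
have term0 n : (0 <= (a ^+ n)%:E * u n)%E by rewrite mule_ge0// lee_fin exprn_ge0// ltW.
apply: lime_le; first by apply: is_cvg_nneseries => n _ _.
apply: nearW => n.
apply: (@le_trans _ _ (\sum_(0 <= i < n) (H * W * q ^+ i)%:E)%E).
  apply: lee_sum => i _; apply: (@le_trans _ _ ((a ^+ i)%:E * (H * theta ^+ i * W)%:E)%E).
    by rewrite lee_wpmul2l ?lee_fin ?exprn_ge0 ?(ltW a0)//; case/andP: (uH i).
  rewrite -EFinM lee_fin (_ : q ^+ i = a ^+ i * theta ^+ i); last exact: exprMn.
  by rewrite le_eqVlt; apply/orP; left; apply/eqP; ring.
rewrite sumEFin lee_fin -mulr_sumr.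
have geo : \sum_(0 <= i < n) q ^+ i = (1 - q ^+ n) / (1 - q).
  elim: n => [|n IH]; first by rewrite big_nil expr0 subrr mul0r.
  rewrite big_nat_recr//= IH exprS; field.
  by rewrite gt_eqF.
rewrite geo (_ : H / (1 - q) * W = H * W * (1 / (1 - q))); last by field; rewrite gt_eqF.
rewrite ler_wpM2l ?mulr_ge0 ?(ltW H0)// ler_wpM2r ?invr_ge0 ?(ltW q1')//.
by rewrite gerBl exprn_ge0.
Qed.

Section distance.
Variables (R : realType) (p : nat).
Variables (d : measure_display) (Omega : measurableType d).
Variable P : probability Omega R.
Variables (xi : 'I_p -> nat -> nat -> {RV P >-> state p}).
Variable eta : nat -> {RV P >-> state p}.
Variable pi : probability (state p) R.
Variable alpha : R.
Local Notation S := (state p).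
Local Notation w := (@moment R p alpha).
Local Open Scope ereal_scope.

Lemma expectationE (f : Omega -> R) : 'E_P[f] = \int[P]_w (f w)%:E.
Proof. by rewrite unlock. Qed.

Lemma distance_from_ge0 x n : 0 <= distance_from xi eta pi alpha x n.
Proof.
apply: (@le_trans _ _ `|expectation_from xi eta x n (cst 0%R) - \int[pi]_y (cst 0%R y)%:E|).
  exact: abse_ge0.
apply: ereal_sup_ubound; exists (cst 0%R) => // y.
by rewrite normr0 addr_ge0// powR_ge0.
Qed.

(** Positive and negative parts obey the growth bound of f. Using the hypothesis for (f1, f2) and
    for (f2, f1) bounds the absolute value from both sides, and finiteness makes the subtractions
    legitimate. *)
Lemma distance_from_le x n (e : R) (Ex : (S -> \bar R) -> \bar R) :
  (forall f : S -> \bar R, (forall y, 0 <= f y) ->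
    \int[P]_w f (GW_from xi eta x n w) = Ex f) ->
  (forall f : S -> \bar R, (forall y, 0 <= f y <= w y + 1) ->
    Ex f \is a fin_num /\ \int[pi]_y f y \is a fin_num) ->
  (forall f1 f2 : S -> \bar R,
    (forall y, 0 <= f1 y <= w y + 1) -> (forall y, 0 <= f2 y <= w y + 1) ->
    Ex f1 + \int[pi]_y f2 y <= Ex f2 + \int[pi]_y f1 y + e%:E) ->
  distance_from xi eta pi alpha x n <= e%:E.
Proof.
move=> ExE Efin H; apply: ge_ereal_sup => _ [f /= fg <-].
pose f1 y := (Num.max (f y) 0)%:E : \bar R.
pose f2 y := (Num.max (- f y) 0)%:E : \bar R.
have f1w y : 0 <= f1 y <= w y + 1.
  rewrite /f1 /moment -EFinD !lee_fin le_max lexx orbT/= ge_max addr_ge0 ?powR_ge0// andbT.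
  exact: le_trans (ler_norm _) (fg y).
have f2w y : 0 <= f2 y <= w y + 1.
  rewrite /f2 /moment -EFinD !lee_fin le_max lexx orbT/= ge_max addr_ge0 ?powR_ge0// andbT.
  by rewrite (le_trans _ (fg y))// -normrN ler_norm.
have f10 y : 0 <= f1 y by case/andP: (f1w y).
have f20 y : 0 <= f2 y by case/andP: (f2w y).
have -> : expectation_from xi eta x n f = Ex f1 - Ex f2.
  rewrite /expectation_from expectationE integralE; congr (_ - _); rewrite -ExE//.
  - by apply: eq_integral => v _; rewrite funeposE /f1 EFin_max.
  - by apply: eq_integral => v _; rewrite funenegE /f2 EFin_max EFinN.
have -> : \int[pi]_y (f y)%:E = \int[pi]_y f1 y - \int[pi]_y f2 y.
  rewrite integralE; congr (_ - _).
  - by apply: eq_integral => v _; rewrite funeposE /f1 EFin_max.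
  - by apply: eq_integral => v _; rewrite funenegE /f2 EFin_max EFinN.
have [E1 I1] := Efin f1 f1w; have [E2 I2] := Efin f2 f2w.
have := H f1 f2 f1w f2w; have := H f2 f1 f2w f1w.
rewrite -(fineK E1) -(fineK E2) -(fineK I1) -(fineK I2).
rewrite -!EFinB -!EFinD !lee_fin ler_norml => h1 h2.
by apply/andP; split; lra.
Qed.

End distance.

(** * The equivalence and the convergence bounds *)

Theorem theorem4 (R : realType) (p : nat) (p_gt0 : (0 < p)%N)
    (d : measure_display) (Omega : measurableType d) (P : probability Omega R)
    (xi : 'I_p -> nat -> nat -> {RV P >-> state p})
    (eta : nat -> {RV P >-> state p})
    (X : nat -> {RV P >-> state p})
    (X_GW : GW_process xi eta X)
    (xi_mean : forall i j : 'I_p,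
       ('E_P[fun w => (xi i 1%N 1%N w j)%:R] < +oo)%E)
    (subcritical : spectral_radius (mean_matrix xi) < 1)
    (pi : probability (state p) R)
    (pi_stationary : stationary xi eta pi)
    (alpha : R) (alpha_gt0 : 0 < alpha) :
  let cond_i : Prop := (\int[pi]_y (norm1 R y `^ alpha)%:E < +oo)%E in
  let cond_ii : Prop :=
    ('E_P[fun w => (norm1 R (eta 1%N w) `^ alpha)%R] < +oo)%E /\
    (forall i : 'I_p, ~ dies_out xi eta i ->
      ('E_P[fun w => (norm1 R (xi i 1%N 1%N w) `^ alpha)%R] < +oo)%E) in
  (cond_i <-> cond_ii) /\
  (cond_i \/ cond_ii ->
    (exists a1 a2 : R, [/\ 1 < a1, 0 < a2 &
      forall x : state p, no_dying_type xi eta x ->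
        (\sum_(0 <= n <oo)
            ((a1 ^+ n)%:E * distance_from xi eta pi alpha x n)
          <= (a2 * (norm1 R x `^ alpha + 1))%:E)%E]) /\
    ((forall i : 'I_p,
        ('E_P[fun w => (norm1 R (xi i 1%N 1%N w) `^ alpha)%R] < +oo)%E) ->
      exists a1 a2 : R, [/\ 1 < a1, 0 < a2 &
        forall x : state p,
          (\sum_(0 <= n <oo)
              ((a1 ^+ n)%:E * distance_from xi eta pi alpha x n)
            <= (a2 * (norm1 R x `^ alpha + 1))%:E)%E])).
Proof.
move=> cond_i cond_ii.
pose Y := GW_family xi eta (X 0%N).
pose w := @moment R p alpha.
have w0 : forall x, (0 <= w x)%E by exact: moment_ge0.
have [b bE] := @exists_laws R p d Omega P _ _ (fun x => measurable_family_sum Y (parents 1%N x)).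
have [k kE] := @exists_laws R p d Omega P _ _ (fun x => measurable_GW_from xi eta x 1%N).
have [h hE] := @exists_law R p d Omega P _ (measurable_RV_preimage eta 1%N).
pose B := kernel_op b; pose K := kernel_op k.
pose M := mean_matrix xi.
have B0 := offspring_kernel0 bE.
have BD := offspring_kernel_add X_GW bE.
have KE := step_kernelE X_GW bE kE hE.
have BM i j : B (coordinate R j) (unit_state i) = (M i j)%:E.
  rewrite /B (offspring_kernel_unit bE); last exact: coordinate_ge0.
  rewrite /M mxE -expectationE fineK// ge0_fin_numE ?xi_mean//.
  by rewrite expectationE; apply: integral_ge0 => w' _; rewrite lee_fin.
have Mcvg := subcritical_exp_cvg subcritical.
have pi_st := stationary_kernel kE pi_stationary.
have M0 := mean_matrix_ge0 BM.
have Mn0 n i j : 0 <= (M ^+ n) i j.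
  elim: n i j => [|n IH] i j; first by rewrite expr0 mxE; case: (i == j).
  by rewrite exprSr mxE sumr_ge0// => l _; rewrite mulr_ge0.
have etaE : ('E_P[fun w => (norm1 R (eta 1%N w) `^ alpha)%R] = \int[h]_x w x)%E.
  by rewrite expectationE hE.
have xiE i : ('E_P[fun w => (norm1 R (xi i 1%N 1%N w) `^ alpha)%R] = B w (unit_state i))%E.
  by rewrite expectationE /B (offspring_kernel_unit bE).
have present_eta j : h (present j) = P (~` [set w | eta 1%N w j = 0%N]).
  rewrite -integral_indicator hE; last by move=> x; rewrite lee_fin.
  have mE : measurable (~` [set w | eta 1%N w j = 0%N]).
    by apply: measurableC;
      exact: (measurable_RV_preimage eta 1%N [set x : state p | x j = 0%N]).
  transitivity (\int[P]_w' (\1_(~` [set w | eta 1%N w j = 0%N]) w')%:E)%E.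
    apply: eq_integral => w' _; rewrite !indicE; congr (_%:R%:E); congr nat_of_bool.
    by apply/idP/idP; rewrite !inE /present/= lt0n => /eqP.
  by rewrite integral_indic// setIT.
have absent_eta j : h (present j) = 0%E <-> P [set w | eta 1%N w j = 0%N] = 1%E.
  have mE : measurable [set w | eta 1%N w j = 0%N].
    exact: (measurable_RV_preimage eta 1%N [set x : state p | x j = 0%N]).
  have PA : P [set w | eta 1%N w j = 0%N] \is a fin_num by rewrite fin_num_measure.
  rewrite present_eta probability_setC// -(fineK PA) -EFinB.
  split => [[/eqP]|[->]]; last by rewrite subrr.
  by rewrite subr_eq0 => /eqP <-.
pose D1 : set 'I_p := dies_out xi eta.
(* If i could have a child of a dying type j, every ancestor type of i would be an ancestor type of
   j one step further back, so i would die out as well. *)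
have MD1 i j : ~ D1 i -> D1 j -> M i j = 0.
  move=> Di Dj; apply/eqP/negP => /negP Mij; apply: Di => l [n Mli].
  apply: Dj; exists n.+1; rewrite exprSr mxE.
  rewrite (bigD1 i)//= ltr_pwDl ?mulr_gt0// ?sumr_ge0//.
  - by rewrite lt_neqAle eq_sym Mij M0.
  - by move=> m _; rewrite mulr_ge0.
have hD1 : (\int[h]_x (\1_(~` avoids D1) x)%:E = 0)%E.
  have mh := mean_op_integral h.
  apply/eqP; rewrite eq_le integral_ge0 ?andbT; last by move=> *; rewrite lee_fin.
  apply: (@le_trans _ _ (\int[h]_x \sum_(j < p)
    (if `[< D1 j >] then (\1_(present j) x)%:E else 0))%E).
    apply: (mean_le mh) => x; first by rewrite lee_fin.
    have t0 j : (0 <= if `[< D1 j >] then (\1_(present j) x)%:E else 0 :> \bar R)%E.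
      by case: ifP => // _; rewrite lee_fin.
    rewrite indicE; case: (boolP (x \in _)) => [|_]; last exact: sume_ge0.
    rewrite inE => /existsNP [j /not_implyP [Dj /eqP xj]].
    rewrite (bigD1 j)//= asboolT// indicE mem_set/=; last by rewrite /present/= lt0n.
    by rewrite leeDl// sume_ge0.
  rewrite (mean_sum mh)/=; last by move=> j x; case: ifP => // _; rewrite lee_fin.
  rewrite big1// => j _; case: asboolP => Dj; last by rewrite integral0.
  (* Taking n = 0 in the definition of dying out shows that a dying type does not immigrate. *)
  rewrite integral_indicator; apply/absent_eta; apply: Dj; exists 0%N.
  by rewrite expr0 mxE eqxx.
have i_ii : cond_i -> cond_ii.
  move=> ci; have wI := increasing_moment p alpha_gt0; split.
    by rewrite etaE; apply: le_lt_trans ci;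
      exact: (immigration_le_stationary B0 BD KE pi_st).
  move=> i Di; rewrite xiE.
  have pi_i : (0 < pi (present i))%E.
    rewrite lt0e measure_ge0 andbT; apply/eqP => pi_i0; apply: Di => j [n Mji].
    by apply/absent_eta; exact: (stationary_absent B0 BD KE pi_st BM pi_i0 Mji).
  (* An infinite offspring moment times the positive mass [pi (present i)] would make the moment of
     [pi] infinite. *)
  have := stationary_present BD KE pi_st 1%N i wI; rewrite /= -/B => Bpi.
  rewrite ltey; apply/eqP => Binf; move: Bpi; rewrite Binf gt0_mulye//.
  by rewrite leNgt ci.
have ii_i : cond_ii -> cond_i.
  move=> [ceta cxi]; apply: (stationary_moment_fin alpha_gt0 B0 BD KE BM Mcvg pi_st MD1 hD1).
    by move=> i Di; have := cxi i Di; rewrite xiE.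
  by rewrite -etaE.
(* Used with D the set of dying types, and with D empty. *)
have ergodic (D : set 'I_p) : (forall i j, ~ D i -> D j -> M i j = 0) ->
    (\int[h]_x (\1_(~` avoids D) x)%:E = 0)%E ->
    (forall i, ~ D i -> (B w (unit_state i) < +oo)%E) ->
    (\int[h]_x w x < +oo)%E ->
    exists a1 a2 : R, [/\ 1 < a1, 0 < a2 & forall x : state p, avoids D x ->
      (\sum_(0 <= n <oo) ((a1 ^+ n)%:E * distance_from xi eta pi alpha x n)
        <= (a2 * (norm1 R x `^ alpha + 1))%:E)%E].
  move=> MD hD Bw hw.
  have [H [theta [H0 t01 bound]]] :=
    geometric_ergodicity alpha_gt0 B0 BD KE BM Mcvg pi_st MD hD Bw hw.
  have /andP[t0 t1] := t01.
  have tp : 0 < 1 + theta by rewrite ltr_wpDl// ltW.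
  exists (2 / (1 + theta)), (H / (1 - 2 / (1 + theta) * theta)); split.
  - by rewrite ltr_pdivlMr// mul1r; lra.
  - by rewrite divr_gt0// subr_gt0 mulrAC ltr_pdivrMr// mul1r; lra.
  move=> x Zx; apply: geometric_weight_series_le => // [|n]; first by rewrite addr_ge0// powR_ge0.
  rewrite distance_from_ge0/=.
  apply: (distance_from_le (Ex := fun f => iter n K f x)).
  - by move=> f f0; exact: (expectation_GW_from X_GW kE).
  - move=> f fw; have f0 y : (0 <= f y)%E by case/andP: (fw y).
    have fw' y : (f y <= w y + 1)%E by case/andP: (fw y).
    split; rewrite ge0_fin_numE; try exact: iter_kernel_ge0; try exact: integral_ge0.
      apply: (le_lt_trans (mean_le (mean_op_iter k n x) f0 fw')).
      rewrite (meanD (mean_op_iter k n x))// (mean_cst (mean_op_iter k n x)) lte_add_pinfty ?ltry//.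
      exact: (iter_immigration_moment_avoids_fin alpha_gt0 B0 BD KE BM Mcvg MD hD Bw hw).
    apply: (le_lt_trans (mean_le (mean_op_integral pi) f0 fw')).
    rewrite [ltLHS](meanD (mean_op_integral pi))// (mean_cst (mean_op_integral pi)).
    rewrite lte_add_pinfty ?ltry//.
    exact: (stationary_moment_fin alpha_gt0 B0 BD KE BM Mcvg pi_st MD hD Bw hw).
  - by move=> f1 f2 f1w f2w; have := bound n x f1 f2 Zx f1w f2w;
    rewrite /moment -EFinD -EFinM.
split; first by split.
move=> c; have [ceta cxi] : cond_ii by case: c => [/i_ii|].
split.
  apply: (ergodic D1) => // [i Di|]; first by rewrite -xiE; exact: cxi.
  by rewrite -etaE.
move=> cxi'.
have [||||a1 [a2 [a11 a20 Ha]]] := ergodic set0.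
- by [].
- rewrite (_ : avoids set0 = setT); last by apply/seteqP; split => // x _ i [].
  by rewrite setCT; apply: integral0_eq => x _; rewrite indic0.
- by move=> i _; rewrite -xiE.
- by rewrite -etaE.
by exists a1, a2; split => // x; exact: Ha.
Qed.
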